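(* Let $W_\alpha$ be a contractive weighted shift (i.e. $\|W_\alpha\|\le 1$) with positive weight sequence $\alpha=(\alpha_n)_{n\ge 0}$ and moment sequence $\gamma=(\gamma_n)_{n\ge 0}$. Then the following statements are equivalent. 1. $W_\alpha$ is moment infinitely divisible ($\mathcal{MID}$). 2. $\log M_\gamma(0)$ and $\log M_\gamma(1)$ are conditionally positive definite (CPD). 3. For every $p>0$, $M_\gamma^p(0)$ and $M_\gamma^p(1)$ are positive definite. 4. For every $p>0$, $M_\gamma^p(0)$ and $M_\gamma^p(1)$ are CPD. 5. The moment sequence $\gamma$ is log completely monotone. 6. The weight sequence $\alpha$ is log completely alternating.
   Context: Weighted shifts: given a bounded sequence $\alpha=(\alpha_n)_{n=0}^\infty$ of positive real numbers, $W_\alpha$ is the bounded operator on $\ell^2(\mathbb{N}_0)$ with $W_\alpha e_n=\alpha_n e_{n+1}$ ($n\ge 0$), where $(e_n)$ is the canonical orthonormal basis. Its moments are $\gamma_0:=1$, $\gamma_n:=\prod_{j=0}^{n-1}\alpha_j^2$ for $n\ge 1$. For $p>0$, the Schur power $W_\alpha^p$ denotes the weighted shift with weights $(\alpha_n^p)_{n\ge0}$ (equivalently, with moments $(\gamma_n^p)$). An operator is subnormal if it is the restriction of a normal operator to a closed invariant subspace. $W_\alpha$ is moment infinitely divisible ($\mathcal{MID}$) if the Schur power $W_\alpha^p$ is subnormal for every $p>0$. Matrices: $M_\gamma(0):=(\gamma_{i+j})_{i,j=0}^\infty$, $M_\gamma(1):=(\gamma_{i+j+1})_{i,j=0}^\infty$.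 $\log M$ is the entrywise logarithm, and $M_\gamma^p(\cdot)$ is the entrywise (Schur/Hadamard) $p$-th power. ''Positive definite'' means positive semi-definite: a finite Hermitian matrix $A$ is positive definite if $v^*Av\ge 0$ for all $v$. A finite Hermitian matrix $A=(a_{ij})$ is CPD if $\sum_{i,j}a_{ij}\bar c_i c_j\ge 0$ for all complex vectors $c$ with $\sum_i c_i=0$. An infinite matrix is positive definite (resp. CPD) if all its finite principal submatrices are. Sequences: for a real sequence $a=(a_k)_{k\ge0}$ put $(\nabla a)_k:=a_k-a_{k+1}$ and $\nabla^n:=\nabla\circ\nabla^{n-1}$, so $(\nabla^n a)_k=\sum_{i=0}^n(-1)^i\binom{n}{i}a_{k+i}$. A sequence $a$ is $n$-monotone if $(\nabla^n a)_k\ge 0$ for all $k\ge 0$, and $n$-alternating if $(\nabla^n a)_k\le 0$ for all $k\ge 0$. It is completely monotone (resp. completely alternating) if it is $n$-monotone (resp. $n$-alternating) for all $n\ge 1$. (Only $n\ge1$ is required, so terms may be negative.) A positive sequence $a$ is log completely monotone (resp. log completely alternating) if $(\ln a_k)_{k\ge0}$ is completely monotone (resp. completely alternating). *)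

(* Defs.v *)
From HB Require Import structures.
From mathcomp Require Import all_boot all_order all_algebra complex.
From mathcomp Require Import all_classical all_reals all_analysis.
From mathcomp Require Import ring lra.

Set Implicit Arguments.
Unset Strict Implicit.
Unset Printing Implicit Defensive.

Import Order.TTheory GRing.Theory Num.Theory Num.Def.
Import numFieldNormedType.Exports.

Local Open Scope classical_set_scope.
Local Open Scope ring_scope.

Section DotNorm.
Variables (C : numClosedFieldType) (U : lmodType C) (f : {dot U for conjC}).

Definition dot_norm (x : U) : C := sqrtC (f x x).

Lemma dot_norm_sqr x : dot_norm x ^+ 2 = f x x.
Proof. exact: sqrtCK. Qed.

Lemma dot_norm_ge0 x : 0 <= dot_norm x.
Proof. exact: sqrt_dnorm_ge0. Qed.

Lemma dot_CauchySchwarz u v : `|f u v| ^+ 2 <= f u u * f v v.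
Proof.
have [->|v0] := eqVneq v 0.
  by rewrite linear0r normr0 expr0n mulr_ge0 ?dnorm_ge0.
have vv : 0 < f v v by rewrite dnorm_gt0.
have vvC : conjC (f v v) = f v v by apply/CrealP; rewrite gtr0_real.
pose a := f u v / f v v.
have aC : conjC a = conjC (f u v) / f v v by rewrite /a rmorphM fmorphV /= vvC.
have : 0 <= f (u - a *: v) (u - a *: v) by exact: dnorm_ge0.
rewrite dnormB dnormZ linearZr_LR /=.
have aE : conjC a * f u v = `|f u v| ^+ 2 / f v v.
  by rewrite aC mulrAC normCK [f u v * _]mulrC.
have -> : `|a| ^+ 2 * f v v = `|f u v| ^+ 2 / f v v.
  by rewrite normCK aC mulrA mulfVK ?gt_eqF// mulrAC -normCK.
rewrite aE (CrealP _); last first.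
  by rewrite rpredM ?rpredV ?rpredX ?normr_real ?gtr0_real.
by rewrite opprD addrA addrK subr_ge0 ler_pdivrMr.
Qed.

Lemma dot_norm_le_mul u v : `|f u v| <= dot_norm u * dot_norm v.
Proof.
rewrite -(@ler_pXn2r _ 2) ?nnegrE ?mulr_ge0 ?dot_norm_ge0//.
by rewrite exprMn !dot_norm_sqr; exact: dot_CauchySchwarz.
Qed.

Lemma dot_normD u v : dot_norm (u + v) <= dot_norm u + dot_norm v.
Proof.
rewrite -(@ler_pXn2r _ 2) ?nnegrE ?addr_ge0 ?dot_norm_ge0//.
rewrite sqrrD !dot_norm_sqr dnormD [leRHS]addrAC lerD2l.
apply: (@le_trans _ _ `|f u v + conjC (f u v)|).
  by rewrite real_ler_norm// CrealE rmorphD /= conjCK addrC.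
apply: (le_trans (ler_normD _ _)).
by rewrite norm_conjC -mulr2n lerMn2r/= dot_norm_le_mul.
Qed.

Lemma dot_normZ a u : dot_norm (a *: u) = `|a| * dot_norm u.
Proof. by rewrite /dot_norm dnormZ rootCMl ?exprn_ge0// sqrCK. Qed.

Lemma dot_norm_eq0 u : dot_norm u = 0 -> u = 0.
Proof. by move/eqP; rewrite sqrt_dnorm_eq0 => /eqP. Qed.

End DotNorm.
HB.mixin Record CompleteNormedModule_isHilbert (R : realType) H
    of CompleteNormedModule R[i] H := {
  hdot : {dot H for @conjC R[i]};
  hdotE : forall x, `|x| ^+ 2 = hdot x x
}.

#[short(type="hilbertType")]
HB.structure Definition Hilbert (R : realType) :=
  {H of CompleteNormedModule R[i] H & CompleteNormedModule_isHilbert R H}.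



(* It is enough to give an inner product on an R[i]-module for which Cauchy
   sequences converge; squared norms avoid square roots in the hypothesis. *)
HB.factory Record Lmodule_isHilbert (R : realType) H of GRing.Lmodule R[i] H := {
  dot : {dot H for @conjC R[i]};
  dot_complete : forall u : nat -> H,
    (forall e : R[i], 0 < e -> exists N, forall m n, (N <= m)%N -> (N <= n)%N ->
       dot (u m - u n) (u m - u n) < e) ->
    exists l, forall e : R[i], 0 < e -> exists N, forall n, (N <= n)%N ->
       dot (u n - l) (u n - l) < e
}.

HB.builders Context (R : realType) H of Lmodule_isHilbert R H.

HB.instance Definition _ := @Lmodule_isNormed.Build R[i] H (dot_norm dot)
  (@dot_normD _ _ dot) (@dot_normZ _ _ dot) (@dot_norm_eq0 _ _ dot).

Let normE (x : H) : `|x| ^+ 2 = dot x x.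
Proof. exact: dot_norm_sqr. Qed.

Let inv_lt (e : R[i]) : 0 < e -> exists N, forall n, (N <= n)%N ->
  n.+1%:R^-1 < e.
Proof.
move=> e0; have eE : e = (complex.Re e)%:C%C by rewrite RRe_real ?gtr0_real.
have e0' : 0 < complex.Re e by rewrite -ltcR -eE.
have [N _ NP] := near_infty_natSinv_lt (PosNum e0').
exists N => n Nn; rewrite eE -(rmorph_nat (real_complex R)) -fmorphV/= ltcR.
exact: (NP n).
Qed.

Let complete (F : set_system H) : ProperFilter F -> cauchy F -> cvg F.
Proof.
move=> FF /cauchyP Fc.
have /choice[u uP] : forall n, exists x, F (ball x (n.+1%:R^-1 : R[i])).
  by move=> n; apply: Fc; rewrite invr_gt0.
have uB m n : `|u m - u n| < m.+1%:R^-1 + n.+1%:R^-1.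
  have [z [zm zn]] := filter_ex (filterI (uP m) (uP n)).
  move: zm zn; rewrite -ball_normE /ball_/= => zm zn.
  rewrite -[u m](subrK z) -addrA (le_lt_trans (ler_normD _ _))// ltrD//.
  by rewrite distrC.
have [|l lP] := dot_complete (u := u).
  move=> e e0; have s0 : 0 < sqrtC e / 2 by rewrite divr_gt0 ?sqrtC_gt0.
  have [N NP] := inv_lt s0; exists N => m n Nm Nn.
  rewrite -normE -[ltRHS]sqrtCK ltr_pXn2r ?nnegrE ?sqrtC_ge0 ?(ltW e0)//.
  by rewrite (lt_trans (uB m n))// [ltRHS]splitr ltrD ?NP.
apply/cvg_ex; exists l; apply/cvgrPdist_lt => e e0.
have s0 : 0 < e / 2 by rewrite divr_gt0.
have [N NP] := inv_lt s0.
have [M MP] := lP _ (exprn_gt0 2 s0).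
pose n := maxn N M.
apply: filterS (uP n) => x; rewrite -ball_normE /ball_/= => xn.
have Mn := MP _ (leq_maxr N M).
rewrite -normE ltr_pXn2r ?nnegrE ?(ltW s0)// distrC in Mn.
rewrite -[l](subrK (u n)) -addrA (le_lt_trans (ler_normD _ _))//.
by rewrite [ltRHS]splitr ltrD// (lt_trans xn)// NP ?leq_maxl.
Qed.

HB.instance Definition _ := Uniform_isComplete.Build H complete.
HB.instance Definition _ := CompleteNormedModule_isHilbert.Build R H normE.

HB.end.

Section SquareSummable.
Variable R : realType.
Implicit Types (x y z : nat -> R[i]^o) (w : R[i]).

Definition sqnormc w : R := complex.Re w ^+ 2 + complex.Im w ^+ 2.

Lemma sqnormcE w : (sqnormc w)%:C%C = `|w| ^+ 2.
Proof.
by rewrite normc_def -rmorphXn sqr_sqrtr// addr_ge0 ?sqr_ge0.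
Qed.

Lemma sqnormc_ge0 w : 0 <= sqnormc w.
Proof. by rewrite addr_ge0 ?sqr_ge0. Qed.

Lemma sqnormcM a w : sqnormc (a * w) = sqnormc a * sqnormc w.
Proof. by apply: complexI; rewrite rmorphM/= !sqnormcE normrM exprMn. Qed.

Lemma sqnormcN w : sqnormc (- w) = sqnormc w.
Proof. by apply: complexI; rewrite !sqnormcE normrN. Qed.

Lemma sqnormcD a w : sqnormc (a + w) <= 2 * sqnormc a + 2 * sqnormc w.
Proof.
case: a w => [a b] [c d]; rewrite /sqnormc/= -subr_ge0.
rewrite [leRHS](_ : _ = (a - c) ^+ 2 + (b - d) ^+ 2); last by ring.
by rewrite addr_ge0 ?sqr_ge0.
Qed.

Definition square_summable x : Prop :=
  cvgn (series (fun n => sqnormc (x n))).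

Definition l2_pred : {pred nat -> R[i]^o} := fun x => `[< square_summable x >].

Lemma l2P x : reflect (square_summable x) (x \in l2_pred).
Proof. exact: asboolP. Qed.

Lemma square_summable_le x (B : R ^nat) :
  (forall n, sqnormc (x n) <= B n) -> cvgn (series B) -> square_summable x.
Proof.
move=> xB; apply: series_le_cvg => // n; first exact: sqnormc_ge0.
exact: le_trans (sqnormc_ge0 _) (xB n).
Qed.

Lemma square_summable_bound x (B : R) :
  (forall n, series (fun k => sqnormc (x k)) n <= B) -> square_summable x.
Proof.
move=> xB; apply: nondecreasing_is_cvgn.
  by apply: nondecreasing_series => n _ _; exact: sqnormc_ge0.
by exists B => _ [n _ <-].
Qed.

Fact l2_submod_closed : submod_closed l2_pred.
Proof.
split=> [|a x y /l2P xs /l2P ys]; apply/l2P.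
  apply: (square_summable_bound (B := 0)) => n.
  by rewrite /series/= big1// => k _; rewrite /sqnormc/= expr0n addr0.
apply: (square_summable_le (B :=
  (2 * sqnormc a) *: (fun n => sqnormc (x n)) + 2 *: (fun n => sqnormc (y n)))).
  move=> n; apply: (le_trans (sqnormcD _ _)).
  by rewrite lerD2r sqnormcM mulrA.
by apply: is_cvg_seriesD; exact: is_cvg_seriesZ.
Qed.

HB.instance Definition _ :=
  GRing.isSubmodClosed.Build R[i] (nat -> R[i]^o) l2_pred l2_submod_closed.

Record l2 : Type := L2 { l2val :> nat -> R[i]^o; l2valP : l2val \in l2_pred }.

HB.instance Definition _ := [isSub for l2val].
HB.instance Definition _ := [Choice of l2 by <:].
HB.instance Definition _ := [SubChoice_isSubLmodule of l2 by <:].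

Lemma l2_summable (x : l2) : square_summable x.
Proof. exact/l2P/l2valP. Qed.

End SquareSummable.

Section L2Hilbert.
Variable R : realType.
Implicit Types (z : nat -> R[i]) (x y : l2 R).

Definition csummable z : Prop :=
  cvgn (series (fun n => complex.Re (z n))) /\
  cvgn (series (fun n => complex.Im (z n))).

(* Sums of complex series are taken separately on real and imaginary parts. *)
Definition csum z : R[i] :=
  (limn (series (fun n => complex.Re (z n)))
   +i* limn (series (fun n => complex.Im (z n))))%C.

Definition l2dot x y : R[i] := csum (fun n => x n * conjC (y n)).

Lemma csummable_le z (B : R ^nat) :
    (forall n, `|complex.Re (z n)| <= B n) ->
    (forall n, `|complex.Im (z n)| <= B n) -> cvgn (series B) ->
  csummable z.
Proof.
move=> rB iB cB; have B0 n : 0 <= B n by exact: le_trans (rB n).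
by split; apply: normed_cvg; apply: (series_le_cvg _ B0 _ cB) => n /=.
Qed.

Lemma csumD z1 z2 : csummable z1 -> csummable z2 ->
  csum (fun n => z1 n + z2 n) = csum z1 + csum z2.
Proof.
move=> [r1 i1] [r2 i2]; rewrite /csum; simpc; congr (_ +i* _)%C.
  rewrite -lim_seriesD//; congr (limn (series _)).
  by apply/funext => n; rewrite fctE; case: (z1 n) (z2 n) => [a b] [c d].
rewrite -lim_seriesD//; congr (limn (series _)).
by apply/funext => n; rewrite fctE; case: (z1 n) (z2 n) => [a b] [c d].
Qed.

Lemma csumZ a z : csummable z -> csum (fun n => a * z n) = a * csum z.
Proof.
case: a => a b [rz iz]; rewrite /csum; simpc; congr (_ +i* _)%C.
  transitivity (limn (series (a *: (fun n => complex.Re (z n))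
                              - b *: (fun n => complex.Im (z n))))).
    congr (limn (series _)); apply/funext => n.
    by rewrite !fctE; case: (z n).
  by rewrite lim_seriesB; [rewrite !lim_seriesZ | exact: is_cvg_seriesZ..].
transitivity (limn (series (a *: (fun n => complex.Im (z n))
                            + b *: (fun n => complex.Re (z n))))).
  congr (limn (series _)); apply/funext => n.
  by rewrite !fctE; case: (z n).
by rewrite lim_seriesD; [rewrite !lim_seriesZ | exact: is_cvg_seriesZ..].
Qed.

Lemma csum_conj z : csummable z ->
  csum (fun n => conjC (z n)) = conjC (csum z).
Proof.
move=> [rz iz]; rewrite /csum.
rewrite -[RHS]/((limn (series _) -i* limn (series _))%C) -lim_seriesN//.
congr (_ +i* _)%C.
  by congr (limn (series _)); apply/funext => n; rewrite ?fctE; case: (z n).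
by congr (limn (series _)); apply/funext => n; rewrite ?fctE; case: (z n).
Qed.

Let norm_cross_le (a b c d : R) :
  `|a * c + b * d| <= (a ^+ 2 + b ^+ 2) + (c ^+ 2 + d ^+ 2).
Proof.
have := sqr_ge0 (a - c); have := sqr_ge0 (b - d).
have := sqr_ge0 (a + c); have := sqr_ge0 (b + d).
have := sqr_ge0 a; have := sqr_ge0 b; have := sqr_ge0 c; have := sqr_ge0 d.
by rewrite !expr2 => *; rewrite ler_norml; apply/andP; split; lra.
Qed.

Lemma l2dot_summable x y : csummable (fun n => x n * conjC (y n)).
Proof.
apply: (csummable_le (B := (fun n => sqnormc (x n)) + (fun n => sqnormc (y n)))).
- move=> n; rewrite fctE; case: (x n) (y n) => [a b] [c d].
  by rewrite /sqnormc/= mulrN opprK norm_cross_le.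
- move=> n; rewrite fctE; case: (x n) (y n) => [a b] [c d].
  by have := norm_cross_le a b (- d) c; rewrite sqrrN [d ^+ 2 + _]addrC.
- by apply: is_cvg_seriesD; exact: l2_summable.
Qed.

Lemma l2dot_conj x y : l2dot x y = conjC (l2dot y x).
Proof.
rewrite /l2dot -csum_conj; last exact: l2dot_summable.
by congr csum; apply/funext => n; rewrite rmorphM/= conjCK mulrC.
Qed.

Fact l2dot_linearl y : linear_for *%R (l2dot ^~ y).
Proof.
move=> a x1 x2; rewrite /l2dot -csumZ; last exact: l2dot_summable.
rewrite -csumD; last exact: l2dot_summable.
  by congr csum; apply/funext => n; rewrite /= mulrDl mulrA.
have := l2dot_summable (a *: x1) y.
by under eq_fun do rewrite /= -mulrA.
Qed.

Fact l2dot_bilinear : bilinear_for *%R (conjC \; *%R) l2dot.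
Proof.
split=> [y|x]; first exact: l2dot_linearl.
move=> a y1 y2; rewrite l2dot_conj l2dot_linearl rmorphD rmorphM/=.
by rewrite -!l2dot_conj.
Qed.

HB.instance Definition _ :=
  bilinear_isBilinear.Build R[i] (l2 R) (l2 R) R[i] *%R (conjC \; *%R) l2dot
    l2dot_bilinear.

Fact l2dot_herm x y : l2dot x y = (-1) ^+ false * conjC (l2dot y x).
Proof. by rewrite expr0 mul1r l2dot_conj. Qed.

HB.instance Definition _ :=
  isHermitianSesquilinear.Build R[i] (l2 R) false conjC l2dot l2dot_herm.

Lemma l2dotxx x : l2dot x x = (limn (series (fun n => sqnormc (x n))))%:C%C.
Proof.
rewrite /l2dot /csum; congr (_ +i* _)%C.
  congr (limn (series _)); apply/funext => n; case: (x n) => a b.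
  by rewrite /sqnormc/= mulrN opprK.
rewrite (_ : series _ = fun=> 0) ?lim_cst//.
apply/funext => n; rewrite /series/= big1// => k _; case: (x k) => a b /=.
by ring.
Qed.

Lemma l2_partial_le x n :
  series (fun k => sqnormc (x k)) n <= limn (series (fun k => sqnormc (x k))).
Proof.
apply: nondecreasing_cvgn_le; last exact: l2_summable.
by apply: nondecreasing_series => k _ _; exact: sqnormc_ge0.
Qed.

Fact l2dot_gt0 x : x != 0 -> 0 < l2dot x x.
Proof.
move=> x0; rewrite l2dotxx ltcR.
have [k xk] : exists k, x k != 0.
  apply: contrapT => /forallNP x00; case/eqP: x0; apply: val_inj.
  by apply/funext => k; apply/eqP; have /negP := x00 k; rewrite negbK.
apply: (lt_le_trans _ (l2_partial_le x k.+1)).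
rewrite /series/= big_nat_recr//= ltr_wpDl//.
  by apply: sumr_ge0 => j _; exact: sqnormc_ge0.
by rewrite -ltcR sqnormcE exprn_gt0// normr_gt0.
Qed.

HB.instance Definition _ := isDotProduct.Build R[i] (l2 R) l2dot l2dot_gt0.

End L2Hilbert.

Section L2Complete.
Variable R : realType.

Let real_cauchy_cvg (v : R ^nat) :
  (forall e, 0 < e -> exists N, forall m n, (N <= m)%N -> (N <= n)%N ->
     (v m - v n) ^+ 2 < e) -> cvgn v.
Proof.
move=> vC; apply/cauchy_cvgP/cauchy_exP => e e0.
have [N NP] := vC _ (exprn_gt0 2 e0).
exists (v N); exists N => // n /= Nn; rewrite -ball_normE /ball_/=.
rewrite -(@ltr_pXn2r _ 2) ?nnegrE ?normr_ge0 ?(ltW e0)//.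
by rewrite real_normK ?num_real// NP.
Qed.

Fact l2_complete (u : nat -> l2 R) :
    (forall e : R[i], 0 < e -> exists N, forall m n, (N <= m)%N -> (N <= n)%N ->
       l2dot (u m - u n) (u m - u n) < e) ->
    exists l : l2 R, forall e : R[i], 0 < e -> exists N, forall n, (N <= n)%N ->
       l2dot (u n - l) (u n - l) < e.
Proof.
move=> uC.
have {}uC (e : R) : 0 < e -> exists N, forall m n, (N <= m)%N -> (N <= n)%N ->
    limn (series (fun k => sqnormc (u m k - u n k))) < e.
  rewrite -ltcR => /uC[N NP]; exists N => m n Nm Nn.
  by have := NP _ _ Nm Nn; rewrite l2dotxx ltcR.
have uk (e : R) k : 0 < e -> exists N, forall m n, (N <= m)%N -> (N <= n)%N ->
    sqnormc (u m k - u n k) < e.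
  move=> /uC[N NP]; exists N => m n Nm Nn.
  apply: le_lt_trans (NP _ _ Nm Nn).
  apply: le_trans (l2_partial_le (u m - u n) k.+1).
  rewrite /series/= big_nat_recr//= lerDr.
  by apply: sumr_ge0 => j _; exact: sqnormc_ge0.
have ReB (a b : R[i]) : complex.Re (a - b) = complex.Re a - complex.Re b.
  by case: a b => [a a'] [b b'].
have ImB (a b : R[i]) : complex.Im (a - b) = complex.Im a - complex.Im b.
  by case: a b => [a a'] [b b'].
have rC k : cvgn (fun n => complex.Re (u n k)).
  apply: real_cauchy_cvg => e /(uk _ k)[N NP]; exists N => m n Nm Nn.
  by apply: le_lt_trans (NP _ _ Nm Nn); rewrite -ReB lerDl sqr_ge0.
have iC k : cvgn (fun n => complex.Im (u n k)).
  apply: real_cauchy_cvg => e /(uk _ k)[N NP]; exists N => m n Nm Nn.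
  by apply: le_lt_trans (NP _ _ Nm Nn); rewrite -ImB lerDr sqr_ge0.
pose l : nat -> R[i]^o := fun k => (limn (fun n => complex.Re (u n k))
                                    +i* limn (fun n => complex.Im (u n k)))%C.
have lK n K : (fun m => series (fun k => sqnormc (u n k - u m k)) K) @ \oo -->
              series (fun k => sqnormc (u n k - l k)) K.
  elim: K => [|K IH].
    rewrite /series/= big_geq// (_ : (fun _ => _) = fun=> 0); first exact: cvg_cst.
    by apply/funext => m; rewrite big_geq.
  rewrite seriesSr (_ : (fun _ => _) = (fun m =>
      series (fun k => sqnormc (u n k - u m k)) K + sqnormc (u n K - u m K))).
    apply: cvgD => //; rewrite /sqnormc; apply: cvgD.
      rewrite !expr2 ReB; apply: cvgM; under eq_fun do rewrite ReB;
      by apply: cvgB; [exact: cvg_cst|exact: rC].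
    rewrite !expr2 ImB; apply: cvgM; under eq_fun do rewrite ImB;
    by apply: cvgB; [exact: cvg_cst|exact: iC].
  by apply/funext => m; rewrite seriesSr.
have le_l (e : R) : 0 < e -> exists N, forall n, (N <= n)%N -> forall K,
    series (fun k => sqnormc (u n k - l k)) K <= e.
  move=> /uC[N NP]; exists N => n Nn K.
  rewrite -(cvg_lim (@Rhausdorff R) (lK n K)); apply: limr_le.
    by apply/cvg_ex; eexists; exact: lK.
  exists N => // m /= Nm; apply: ltW; apply: le_lt_trans (NP _ _ Nn Nm).
  exact: (l2_partial_le (u n - u m)).
have [N0 N0P] := le_l 1 ltr01.
have dP : (l2val (u N0) - l) \in @l2_pred R.
  by apply/l2P; apply: (square_summable_bound (B := 1)) => K; exact: N0P.
have lP : l \in @l2_pred R.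
  have -> : l = l2val (u N0 - L2 dP) by rewrite /= opprB addrCA subrr addr0.
  exact: l2valP.
exists (L2 lP) => e e0.
have eE : e = (complex.Re e)%:C%C by rewrite RRe_real ?gtr0_real.
have e0' : 0 < complex.Re e by rewrite -ltcR -eE.
have [|N NP] := le_l (complex.Re e / 2); first by rewrite divr_gt0.
exists N => n Nn; rewrite l2dotxx eE ltcR.
apply: (@le_lt_trans _ _ (complex.Re e / 2)); last first.
  by rewrite ltr_pdivrMr// ltr_pMr// ltr1n.
apply: limr_le; first exact: (@l2_summable _ (u n - L2 lP)).
by exists 0%N => // K _; exact: NP.
Qed.

HB.instance Definition _ := Lmodule_isHilbert.Build R (l2 R) l2_complete.

Lemma l2_hdotE (x y : l2 R) : hdot x y = l2dot x y.
Proof. by []. Qed.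

End L2Complete.

Section Operators.
Variable R : realType.
Implicit Types H K : hilbertType R.

Definition opnorm H K (T : H -> K) : \bar R :=
  ereal_sup [set (complex.Re `|T x|)%:E | x in [set x : H | `|x| <= 1]].

Definition adjoint H (T S : H -> H) : Prop :=
  forall x y, hdot (T x) y = hdot x (S y).

(* Bounded linear operators are the continuous ones; the adjoint of a bounded
   operator is automatically bounded. *)
Definition normal_operator H (N : {linear H -> H}) : Prop :=
  continuous N /\
  exists2 S : {linear H -> H}, adjoint N S & forall x, N (S x) = S (N x).

(* H is viewed as a subspace of K through the linear isometry V; its image is
   closed, as H is complete, and it is invariant under N by the last clause,
   which says that T is the restriction of N. *)
Definition subnormal H (T : {linear H -> H}) : Prop :=
  exists (K : hilbertType R) (N : {linear K -> K}) (V : {linear H -> K}),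
    [/\ normal_operator N,
        forall x y, hdot (V x) (V y) = hdot x y &
        forall x, V (T x) = N (V x)].

End Operators.

Section WeightedShift.
Variable R : realType.
Implicit Types (alpha : R ^nat) (x : l2 R).

Definition shift_seq alpha (x : nat -> R[i]^o) : nat -> R[i]^o :=
  fun n => if n is m.+1 then (alpha m)%:C%C * x m else 0.

Fact shift_seq_l2 alpha : bounded_fun alpha ->
  forall x, shift_seq alpha x \in @l2_pred R.
Proof.
move=> [M [Mreal aM]] x.
have {}aM n : `|alpha n| <= M + 1 by apply: aM; rewrite ?ltrDl.
apply/l2P; apply: (square_summable_bound
  (B := (M + 1) ^+ 2 * limn (series (fun k => sqnormc (x k))))) => -[|n].
  rewrite /series/= big_geq// mulr_ge0 ?sqr_ge0//.
  by apply: le_trans (l2_partial_le x 0); rewrite /series/= big_geq.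
rewrite /series/= big_nat_recl//= /sqnormc/= expr0n addr0 add0r.
apply: (@le_trans _ _ ((M + 1) ^+ 2 * series (fun k => sqnormc (x k)) n)).
  rewrite /series/= mulr_sumr; apply: ler_sum => k _.
  rewrite -/(sqnormc _) sqnormcM ler_wpM2r ?sqnormc_ge0//.
  rewrite /sqnormc/= expr0n addr0 -[leLHS]real_normK ?num_real//.
  by rewrite ler_pXn2r ?nnegrE ?(le_trans _ (aM k)).
by rewrite ler_wpM2l ?sqr_ge0 ?l2_partial_le.
Qed.

Definition wshift alpha (alpha_bd : bounded_fun alpha) (x : l2 R) : l2 R :=
  L2 (shift_seq_l2 alpha_bd x).

Fact wshift_linear alpha (alpha_bd : bounded_fun alpha) :
  linear (wshift alpha_bd).
Proof.
move=> a x y; apply: val_inj; apply/funext => -[|n] /=.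
  by rewrite !fctE/= scaler0 addr0.
by rewrite !fctE/= mulrDr mulrCA.
Qed.

HB.instance Definition _ alpha (alpha_bd : bounded_fun alpha) :=
  GRing.isLinear.Build R[i] (l2 R) (l2 R) _ (wshift alpha_bd)
    (wshift_linear alpha_bd).

Fact l2_basis_subproof (n : nat) :
  (fun k => (k == n)%:R : R[i]^o) \in @l2_pred R.
Proof.
apply/l2P; apply: (square_summable_bound (B := 1)) => N.
rewrite /series/= (eq_bigr (fun k => if k == n then 1 else 0)); last first.
  by move=> k _; case: eqP => _; rewrite /sqnormc/= ?expr1n ?expr0n ?addr0.
rewrite -big_mkcond/=; have [nN|Nn] := ltnP n N.
  by rewrite big_nat1_eq nN.
by rewrite big_nat1_eq ltnNge Nn.
Qed.

Definition l2_basis (n : nat) : l2 R := L2 (l2_basis_subproof n).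

Lemma wshift_basis alpha (alpha_bd : bounded_fun alpha) n :
  wshift alpha_bd (l2_basis n) = (alpha n)%:C%C *: l2_basis n.+1.
Proof.
apply: val_inj; apply/funext => -[|k] /=; rewrite !fctE/= ?scaler0//.
by rewrite eqSS; case: eqP => [->//|_]; rewrite mulr0 scaler0.
Qed.

Definition schur_pow alpha (p : R) : R ^nat := fun n => alpha n `^ p.

Fact schur_pow_bounded alpha (p : R) :
  bounded_fun alpha -> 0 < p -> bounded_fun (schur_pow alpha p).
Proof.
move=> [M [Mreal aM]] p0; pose C := M + 1.
have {}aM n : `|alpha n| <= C by apply: aM; rewrite ?ltrDl.
have C0 : 0 <= C by exact: le_trans (aM 0%N).
exists (C `^ p + 1); split; first exact: num_real.
move=> B /ltW CB n _; apply: le_trans CB; rewrite /schur_pow ger0_norm ?powR_ge0//.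
have [a0|a0] := leP 0 (alpha n).
  rewrite ler_wpDr// ge0_ler_powR ?nnegrE ?(ltW p0)//.
  by rewrite (le_trans (ler_norm _)).
by rewrite /powR lt_eqF// ln0 ?(ltW a0)// mulr0 expR0 lerDr powR_ge0.
Qed.

Definition moment_infinitely_divisible alpha (alpha_bd : bounded_fun alpha) :=
  forall (p : R) (p_gt0 : 0 < p),
    subnormal (wshift (schur_pow_bounded alpha_bd p_gt0)).

Definition moment alpha : R ^nat := fun n => \prod_(j < n) alpha j ^+ 2.

End WeightedShift.

Section InfiniteMatrices.
Variable R : realType.
Local Open Scope sesquilinear_scope.

Definition posdefmx n (A : 'M[R[i]]_n) : Prop :=
  A \is hermsymmx /\
  forall v : 'cV[R[i]]_n, 0 <= (v ^t conjC *m A *m v) 0 0.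

Definition cpdmx n (A : 'M[R[i]]_n) : Prop :=
  A \is hermsymmx /\
  forall c : 'I_n -> R[i], \sum_i c i = 0 ->
    0 <= \sum_i \sum_j A i j * conjC (c i) * c j.

(* Infinite matrices are real here; a finite principal submatrix is given by
   an increasing enumeration of its indices. *)
Implicit Types M : nat -> nat -> R.

Definition principal_submx M n (s : 'I_n -> nat) : 'M[R[i]]_n :=
  \matrix_(i, j) (M (s i) (s j))%:C%C.

Definition inf_posdef M : Prop :=
  forall n (s : 'I_n -> nat), {homo s : i j / (i < j)%N} ->
    posdefmx (principal_submx M s).

Definition inf_cpd M : Prop :=
  forall n (s : 'I_n -> nat), {homo s : i j / (i < j)%N} ->
    cpdmx (principal_submx M s).

Definition moment_mx (gamma : R ^nat) (k : nat) : nat -> nat -> R :=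
  fun i j => gamma (i + j + k)%N.

Definition log_mx M : nat -> nat -> R := fun i j => ln (M i j).

Definition schur_pow_mx M (p : R) : nat -> nat -> R := fun i j => M i j `^ p.

End InfiniteMatrices.

Section Monotonicity.
Variable R : realType.
Implicit Types a : R ^nat.

Definition nabla a : R ^nat := fun k => a k - a k.+1.

Definition n_monotone n a : Prop := forall k, 0 <= iter n nabla a k.

Definition n_alternating n a : Prop := forall k, iter n nabla a k <= 0.

Definition completely_monotone a : Prop :=
  forall n, (1 <= n)%N -> n_monotone n a.

Definition completely_alternating a : Prop :=
  forall n, (1 <= n)%N -> n_alternating n a.

(* The clause 0 < a k keeps ln away from its default value 0. *)
Definition log_completely_monotone a : Prop :=
  (forall k, 0 < a k) /\ completely_monotone (fun k => ln (a k)).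

Definition log_completely_alternating a : Prop :=
  (forall k, 0 < a k) /\ completely_alternating (fun k => ln (a k)).

End Monotonicity.

(* Main.v *)
From HB Require Import structures.
Require Import Defs.
From mathcomp Require Import all_boot all_order all_algebra complex.
From mathcomp Require Import all_classical all_reals all_analysis.
From mathcomp Require Import ring lra zify.

(** Write L_b for the functional X^k |-> b_k on polynomials, and call b positive
    if L_b(p^2) >= 0 for all real p, i.e. if its Hankel matrix is positive.

    (2) => (5). A quadratic form in c with sum zero is one in (1 - X)q, so (2)
    says that b = nabla^2 (ln gamma) and its shift are positive; contractivity
    makes b bounded. For such b the sequence k |-> L_b(X^k p^2) is log-convex and
    bounded, hence nonincreasing, so the class is stable under nabla and b is
    completely monotone.

    (5) => (3). gamma^p = exp (p ln gamma) is completely monotone by the Leibniz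
    rule for nabla, and completely monotone sequences are positive because
    L_b is nonnegative on the Bernstein polynomials of p^2, which tend to p^2.

    (3) => (4) is trivial, and (4) => (2) since (gamma^p - 1)/p tends to ln gamma.

    (3) => (1). No measure is needed: the monomials z^i conj(z)^j get the inner
    products that a rotation invariant measure would give them. Gram-Schmidt
    realises them as vectors of l^2, where multiplication by z becomes a normal
    contraction. On the orthonormal family z^n / sqrt gamma_n it acts as the shift.

    (1) => (3). If N is a normal extension and v the image of e_0, then
    gamma_(i+j) is the inner product of N*^i N^i v and N*^j N^j v.

    (5) <=> (6). nabla (ln gamma) = -2 ln alpha, and ln alpha <= 0. *)

Set Implicit Arguments.
Unset Strict Implicit.
Unset Printing Implicit Defensive.

Import Order.TTheory GRing.Theory Num.Theory Num.Def.
Import numFieldNormedType.Exports.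

Local Open Scope classical_set_scope.
Local Open Scope ring_scope.

(** * Moment functionals and Hankel positivity *)

Section PolyExt.
Variables (F : nzRingType) (V : lmodType F).
Implicit Types (f : nat -> V) (p q : {poly F}).

(** This one construction serves the moment functionals, the kernel forms, and the operators sending
    monomials to monomials. *)
Definition poly_ext f p : V := \sum_(i < size p) p`_i *: f i.

Lemma poly_ext_widen f p n : (size p <= n)%N ->
  poly_ext f p = \sum_(i < n) p`_i *: f i.
Proof.
move=> pn; rewrite /poly_ext (big_ord_widen n (fun i => p`_i *: f i)) //.
rewrite big_mkcond; apply: eq_bigr => i _.
by case: ltnP => // /leq_sizeP -> //; rewrite scale0r.
Qed.

Fact poly_ext_linear f : linear (poly_ext f).
Proof.
move=> a p q; pose n := maxn (size p) (size q).
rewrite !(@poly_ext_widen _ _ n) ?leq_maxl ?leq_maxr //; last first.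
  rewrite (leq_trans (size_polyD _ _)) // geq_max leq_maxr andbT.
  by rewrite (leq_trans (size_scale_leq _ _)) ?leq_maxl.
rewrite scaler_sumr -big_split /=; apply: eq_bigr => i _.
by rewrite coefD coefZ scalerDl scalerA.
Qed.

HB.instance Definition _ f :=
  GRing.isLinear.Build F {poly F} V _ (poly_ext f) (poly_ext_linear f).

Lemma poly_extXn f n : poly_ext f 'X^n = f n.
Proof.
rewrite (@poly_ext_widen _ _ n.+1) ?size_polyXn //.
rewrite big_ord_recr /= coefXn eqxx scale1r big1 ?add0r // => i _.
by rewrite coefXn ltn_eqF // scale0r.
Qed.

Lemma poly_sum_Xn p : p = \sum_(i < size p) p`_i *: 'X^i.
Proof. by rewrite -[LHS]coefK poly_def. Qed.

End PolyExt.

Lemma linear_poly_ext (F : nzRingType) (V W : lmodType F)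
    (g : {linear V -> W}) (f : nat -> V) p :
  g (poly_ext f p) = poly_ext (fun i => g (f i)) p.
Proof. by rewrite linear_sum; apply: eq_bigr => i _; rewrite linearZ. Qed.

Section MomentFunctional.
Variable R : realType.
Implicit Types (b : R ^nat) (p q : {poly R}).

Definition moment_functional b : {poly R} -> R := poly_ext (b : nat -> R^o).

Local Notation L := moment_functional.

Lemma moment_functionalE b p : L b p = \sum_(i < size p) p`_i * b i.
Proof. by []. Qed.

HB.instance Definition _ b :=
  GRing.isLinear.Build R {poly R} R _ (moment_functional b)
    (poly_ext_linear (b : nat -> R^o)).

Lemma moment_functionalXn b n : L b 'X^n = b n.
Proof. exact: poly_extXn. Qed.

Lemma moment_functional_mulX b p : L b ('X * p) = L (fun k => b k.+1) p.
Proof.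
rewrite [in LHS](poly_sum_Xn p) mulr_sumr linear_sum /=; apply: eq_bigr => i _.
by rewrite -scalerAr -exprS linearZ /= moment_functionalXn.
Qed.

Lemma moment_functional_nabla b p : L (nabla b) p = L b ((1 - 'X) * p).
Proof.
rewrite mulrBl mul1r linearB /= moment_functional_mulX !moment_functionalE -sumrB.
by apply: eq_bigr => i _; rewrite /nabla mulrBr.
Qed.

Lemma moment_functional_cst (a : R) p : L (fun=> a) p = p.[1] * a.
Proof.
rewrite moment_functionalE horner_coef mulr_suml.
by apply: eq_bigr => i _; rewrite expr1n mulr1.
Qed.

Lemma moment_functional_sqr (I : finType) b (c : I -> R) (m : I -> nat) :
  L b ((\sum_i c i *: 'X^(m i)) ^+ 2) =
  \sum_i \sum_j c i * c j * b (m i + m j)%N.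
Proof.
rewrite expr2 mulr_suml linear_sum /=; apply: eq_bigr => i _.
rewrite mulr_sumr linear_sum /=; apply: eq_bigr => j _.
rewrite -scalerAl -scalerAr scalerA -exprD linearZ /=.
by rewrite moment_functionalXn.
Qed.

Definition hankel_psd b := forall p, 0 <= L b (p ^+ 2).

Lemma hankel_psd_ge0 b : hankel_psd b -> 0 <= b 0%N.
Proof.
by move=> /(_ 1); rewrite expr1n -(expr0 'X) moment_functionalXn.
Qed.

(** ['X^2 * p ^+ 2] is again a square. *)
Lemma hankel_psd_shift2 b : hankel_psd b -> hankel_psd (fun k => b k.+2).
Proof.
move=> bP p; rewrite -(moment_functional_mulX (fun k => b k.+1)).
rewrite -moment_functional_mulX mulrA -expr2 -exprMn; exact: bP.
Qed.

(** Positivity propagates in steps of two, so the induction carries two consecutive shifts. *)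
Lemma hankel_psd_shift b k : hankel_psd b -> hankel_psd (fun k => b k.+1) ->
  hankel_psd (fun i => b (i + k)%N).
Proof.
move=> b0 b1; have [b0k b1k] : hankel_psd (fun i => b (i + k)%N) /\
    hankel_psd (fun i => b (i + k).+1); last exact: b0k.
elim: k => [|k [IH0 IH1]]; first by under eq_fun do rewrite addn0;
  split => //; under eq_fun do rewrite addn0.
under eq_fun do rewrite addnS; split => //.
under eq_fun do rewrite addnS.
exact: (hankel_psd_shift2 IH0).
Qed.

Lemma quadratic_form_CS (x y z : R) :
  (forall t, 0 <= x - 2 * t * y + t ^+ 2 * z) -> y ^+ 2 <= x * z.
Proof.
move=> H; have [z0|z0|z0] := ltgtP z 0.
(* For this [t], [t ^+ 2 * z] is at most [- t * (x + 2 * |y| + 1)]; as [0 <= x] and [1 <= t], the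
   whole form is at most [- t]. *)
- have := H (Num.max 1 ((x + 2 * `|y| + 1) / - z)).
  set t := Num.max _ _ => Ht; exfalso.
  have t1 : 1 <= t by rewrite le_max lexx.
  have tz : x + 2 * `|y| + 1 <= t * - z.
    by rewrite -ler_pdivrMr ?oppr_gt0 // le_max lexx orbT.
  have x0 : 0 <= x by have := H 0; rewrite expr0n /= !(mulr0, mul0r) subr0 addr0.
  have : - `|y| <= y by rewrite lerNl ler_normr lexx orbT.
  move=> hy; have := normr_ge0 y; nra.
- have := H (y / z); have zz : z != 0 by rewrite gt_eqF.
  have -> : x - 2 * (y / z) * y + (y / z) ^+ 2 * z = x - y ^+ 2 / z by field.
  by rewrite subr_ge0 ler_pdivrMr.
- rewrite z0 mulr0; rewrite z0 in H.
  have [->|y0] := eqVneq y 0; first by rewrite expr0n.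
  have := H ((x + 1) / (2 * y)).
  have -> : x - 2 * ((x + 1) / (2 * y)) * y + ((x + 1) / (2 * y)) ^+ 2 * 0
    = -1 by field.
  by rewrite ler0N1.
Qed.

(* Log-convexity makes the increments of [a] nondecreasing, so a positive first
   increment would force unbounded growth. *)
Lemma logconvex_bounded_le (a : R ^nat) (M : R) :
  (forall k, 0 <= a k <= M) -> (forall k, a k.+1 ^+ 2 <= a k * a k.+2) ->
  a 1%N <= a 0%N.
Proof.
move=> aM ac; rewrite leNgt; apply/negP => a01.
have a0 : 0 < a 0%N.
  rewrite lt_neqAle (andP (aM 0%N)).1 andbT; apply/eqP => a0.
  have := ac 0%N; rewrite -a0 mul0r => a1.
  by have : 0 < a 1%N ^+ 2; [rewrite exprn_gt0 // a0 | rewrite ltNge a1].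
pose d := a 1%N - a 0%N; have d0 : 0 < d by rewrite subr_gt0.
have inc k : [/\ 0 < a k, d <= a k.+1 - a k & a k < a k.+1].
  elim: k => [//|k [ak dk akS]].
  have akS0 : 0 < a k.+1 by apply: lt_trans akS.
  (* Log-convexity gives a_k (a_(k+2) - 2 a_(k+1) + a_k) >= (a_(k+1) - a_k)^2. *)
  have h : a k.+1 - a k <= a k.+2 - a k.+1.
    have := ac k; rewrite -subr_ge0 => h; rewrite -subr_ge0 -(pmulr_rge0 _ ak).
    have := sqr_ge0 (a k.+1 - a k); nra.
  by split=> //; [apply: le_trans h|rewrite -subr_gt0 (lt_le_trans _ h) ?subr_gt0].
have lb k : d *+ k <= a k.
  elim: k => [|k IH]; first by rewrite mulr0n ltW.
  by have [_ h _] := inc k; rewrite mulrSr; lra.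
have [n nM] : exists n, M / d < n%:R.
  by exists (Num.truncn (M / d)).+1; apply: truncnS_gt.
have := le_trans (lb n) (andP (aM n)).2; apply/negP; rewrite -ltNge.
by rewrite -mulr_natl -ltr_pdivrMr.
Qed.

(** These are the moment sequences of positive measures on [0, 1]: the two positivity clauses place
    the measure on the half-line, and boundedness confines it to [0, 1]. *)
Definition bounded_stieltjes b := [/\ hankel_psd b, hankel_psd (fun k => b k.+1)
  & exists M, forall k, `|b k| <= M].

Lemma bounded_stieltjes_shift b :
  bounded_stieltjes b -> bounded_stieltjes (fun k => b k.+1).
Proof.
by move=> [b0 b1 [M bM]]; split => //; [exact: hankel_psd_shift2|exists M].
Qed.

Lemma hankel_psd_nabla b : bounded_stieltjes b -> hankel_psd (nabla b).
Proof.
move=> [b0 b1 [M bM]] p.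
pose a k := L b ('X^k * p ^+ 2).
have aE k : a k = L (fun i => b (i + k)%N) (p ^+ 2).
  rewrite /a; elim: k b {b0 b1 bM a} => [|k IH] b.
    by rewrite mul1r; under [in RHS]eq_fun do rewrite addn0.
  rewrite exprS -mulrA moment_functional_mulX IH.
  by congr (L _ _); apply/funext => i; rewrite addnS.
have a_ge0 k : 0 <= a k by rewrite aE; apply: hankel_psd_shift.
suff : a 1%N <= a 0%N.
  by rewrite moment_functional_nabla mulrBl mul1r linearB /= /a expr1 mul1r subr_ge0.
apply: (@logconvex_bounded_le _ (\sum_(i < size (p ^+ 2)) `|(p ^+ 2)`_i| * M)).
  move=> k; rewrite a_ge0 /= aE moment_functionalE; apply: ler_sum => i _.
  apply: (le_trans (ler_norm _)); rewrite normrM ler_wpM2l //.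
(* Log-convexity of [a] is the discriminant inequality for the nonnegative quadratic t |-> L_b(X^k
   (p (1 - tX))^2). *)
move=> k; apply: quadratic_form_CS => t.
have := hankel_psd_shift k b0 b1 (p * (1 - t *: 'X)).
have -> : (p * (1 - t *: 'X)) ^+ 2 = p ^+ 2 - (2 * t) *: ('X * p ^+ 2)
    + t ^+ 2 *: ('X * ('X * p ^+ 2)).
  rewrite -!mul_polyC !(polyCM, rmorphXn) /=; ring.
rewrite linearD linearB !linearZ /= !moment_functional_mulX !aE.
by under [fun i => b (i + k.+1)%N]eq_fun do rewrite addnS;
   under [fun i => b (i + k.+2)%N]eq_fun do rewrite !addnS.
Qed.

Lemma bounded_stieltjes_nabla b :
  bounded_stieltjes b -> bounded_stieltjes (nabla b).
Proof.
move=> bS; split; first exact: hankel_psd_nabla.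
  exact: (hankel_psd_nabla (bounded_stieltjes_shift bS)).
have [_ _ [M bM]] := bS; exists (M + M) => k.
by rewrite (le_trans (ler_normB _ _)) // lerD.
Qed.

(** The class is stable under [nabla] and under the shift, so it is enough that its members have a
    nonnegative first term. *)
Lemma bounded_stieltjes_cm b n : bounded_stieltjes b -> n_monotone n b.
Proof.
elim: n b => [|n IH] b bS k; last first.
  by rewrite iterSr; apply: IH; exact: bounded_stieltjes_nabla.
elim: k b bS => [b [+ _ _]|k IH b /bounded_stieltjes_shift/IH//].
exact: hankel_psd_ge0.
Qed.

End MomentFunctional.

(** * Completely monotone sequences *)

Section Bernstein.
Variable R : realType.
Implicit Types (b : R ^nat) (p f : {poly R}).
Local Notation L := moment_functional.

Lemma cvgn_ge0 (u : R ^nat) (l : R) :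
  u @ \oo --> l -> (forall n, 0 <= u n) -> 0 <= l.
Proof.
move=> ul u0; rewrite -(cvg_lim (@Rhausdorff R) ul); apply: limr_ge.
  by apply/cvg_ex; exists l.
exact: nearW.
Qed.

Lemma cvgn_sum (I : finType) (u : I -> R ^nat) (l : I -> R) :
  (forall i, u i @ \oo --> l i) ->
  (fun n => \sum_i u i n) @ \oo --> \sum_i l i.
Proof.
move=> ul; rewrite (_ : (fun n => \sum_i u i n) = \sum_i u i).
  by elim/big_ind2 : _ => [|f x g y|i _]; [exact: cvg_cst|exact: cvgD|exact: ul].
by apply/funext => n; rewrite fct_sumE.
Qed.

(** [nabla] is dual to multiplication by 1 - X; thus complete monotonicity becomes nonnegativity of
    [L b] on the Bernstein basis. *)
Lemma moment_functional_bernstein b n k :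
  L b ((1 - 'X) ^+ n * 'X^k) = iter n (@nabla R) b k.
Proof.
elim: n b => [|n IH] b; first by rewrite mul1r moment_functionalXn.
by rewrite exprS -mulrA -moment_functional_nabla IH iterSr.
Qed.

Lemma mul_deriv_exp f n : f * (f ^+ n)^`() = f^`() * f ^+ n *+ n.
Proof.
by rewrite deriv_exp mulrnAr; case: n => [|n] //=; rewrite mulrCA -exprS.
Qed.

(** The Bernstein approximation of order [n] of x |-> x^m. Limits are taken along [n.+1], so that
    the nodes k/n are genuine quotients. *)
Definition bernstein_poly (n m : nat) : {poly R} :=
  \sum_(k < n.+1) (k%:R / n%:R) ^+ m *: (((1 - 'X) ^+ (n - k) * 'X^k) *+ 'C(n, k)).

Lemma bernstein_poly0 n : bernstein_poly n 0 = 1.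
Proof.
rewrite -[RHS](expr1n _ n) -[X in X ^+ n](subrK 'X) exprDn.
by apply: eq_bigr => k _; rewrite expr0 scale1r.
Qed.

(* [x(1-x)] times the derivative of [x^k (1-x)^(n-k)] is [(k - nx)] times it. *)
Lemma bernstein_polyS n m : bernstein_poly n.+1 m.+1 =
  'X * bernstein_poly n.+1 m
  + n.+1%:R^-1 *: ('X * (1 - 'X) * (bernstein_poly n.+1 m)^`()).
Proof.
rewrite /bernstein_poly linear_sum /= !mulr_sumr scaler_sumr -big_split /=.
apply: eq_bigr => k _; rewrite derivZ derivMn -!scalerAr -!mulrnAr scalerA.
rewrite exprSr -scalerA [n.+1%:R^-1 * _]mulrC -[in RHS]scalerA -scalerDr.
congr (_ *: _); rewrite !mulrnAr -!scalerMnr -mulrnDl; congr (_ *+ _).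
rewrite derivM; set g := (1 - 'X) ^+ _; set h := 'X^k.
have Eg : (1 - 'X) * g^`() = - g *+ (n.+1 - k).
  by rewrite mul_deriv_exp derivB derivX derivC sub0r mulN1r.
have Eh : 'X * h^`() = h *+ k by rewrite mul_deriv_exp derivX mul1r.
have -> : 'X * (1 - 'X) * (g^`() * h + g * h^`()) =
  'X * h * ((1 - 'X) * g^`()) + (1 - 'X) * g * ('X * h^`()) by ring.
rewrite Eg Eh -!mul_polyC polyCM.
have n0 : n.+1%:R != 0 :> R by rewrite pnatr_eq0.
have -> : 'X * (g * h) = n.+1%:R^-1%:P * ('X * (g * h) *+ n.+1).
  by rewrite mulrnAr mul_polyC -scaler_nat scalerA mulfV ?scale1r.
rewrite polyC_natr.
have -> : 'X * (g * h) *+ n.+1 = 'X * (g * h) *+ k + 'X * (g * h) *+ (n.+1 - k).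
  by rewrite -mulrnDr subnKC // -ltnS.
by move: (n.+1 - k)%N => j; ring.
Qed.

(** The common degree bound [s] makes any [L b] continuous for this convergence, being a finite sum
    of coefficients. *)
Definition coef_cvg (f : nat -> {poly R}) (g : {poly R}) :=
  (forall i, (f n)`_i @[n --> \oo] --> g`_i) /\
  exists s, forall i, (s <= i)%N -> g`_i = 0 /\ forall n, (f n)`_i = 0.

Lemma moment_functional_cvg b (f : nat -> {poly R}) g : coef_cvg f g ->
  L b (f n) @[n --> \oo] --> L b g.
Proof.
move=> [fg [s sP]].
rewrite (_ : L b g = \sum_(i < s) g`_i * b i); last first.
  by apply: poly_ext_widen; apply/leq_sizeP => i /sP[].
rewrite (_ : (fun n => _) = fun n => \sum_(i < s) (f n)`_i * b i).
  by apply: cvgn_sum => i; apply: cvgMr_tmp; exact: fg.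
apply/funext => n; apply: poly_ext_widen.
by apply/leq_sizeP => i /sP[_ ->].
Qed.

(** In the recursion [bernstein_polyS] the derivative term has convergent coefficients and the
    factor [n.+1%:R^-1], so only ['X] times the previous limit survives. [E] is that recursion read
    on coefficients. *)
Lemma bernstein_poly_cvg m : coef_cvg (fun n => bernstein_poly n.+1 m) 'X^m.
Proof.
elim: m => [|m [IH [s sP]]].
  under eq_fun do rewrite bernstein_poly0.
  split; first by move=> i; exact: cvg_cst.
  by exists 1%N => i i1; rewrite coef1 gtn_eqF.
have E n i : (bernstein_poly n.+1 m.+1)`_i.+1 = (bernstein_poly n.+1 m)`_i
    + n.+1%:R^-1 * ((bernstein_poly n.+1 m)`_i.+1 *+ i.+1
        - (bernstein_poly n.+1 m)`_i *+ i).
  rewrite bernstein_polyS coefD coefXM /= coefZ -mulrA coefXM /= mulrBl mul1r.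
  rewrite coefB coefXM !coef_deriv; case: i => [|i] //=.
have E0 n : (bernstein_poly n.+1 m.+1)`_0 = 0.
  by rewrite bernstein_polyS coefD coefXM /= coefZ -mulrA coefXM /= mulr0 addr0.
split; last first.
  exists s.+1 => -[|i] // si; rewrite exprS coefXM /=.
  have [-> h] := sP i si; have [_ h'] := sP i.+1 (leqW si).
  by split => // n; rewrite E h h' !mul0rn subr0 mulr0 addr0.
case=> [|i]; first by under eq_fun do rewrite E0; rewrite exprS coefXM /=; exact: cvg_cst.
under eq_fun do rewrite E; rewrite exprS coefXM /=.
have cD : n.+1%:R^-1 * ((bernstein_poly n.+1 m)`_i.+1 *+ i.+1
    - (bernstein_poly n.+1 m)`_i *+ i) @[n --> \oo]
    --> (0 * ('X^m`_i.+1 *+ i.+1 - 'X^m`_i *+ i) : R).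
  apply: cvgM; first exact: cvg_harmonic.
  by apply: cvgB; apply: cvgMn; exact: IH.
by rewrite mul0r in cD; rewrite -['X^m`_i]addr0; apply: cvgD => //; exact: IH.
Qed.

(** Replacing each monomial of p^2 by its Bernstein polynomial turns L_b(p^2) into the sum of the
    w_k p(x_k)^2 over the nodes x_k, where w_k >= 0 by complete monotonicity. *)
Lemma cm_hankel_psd b : (forall n, n_monotone n b) -> hankel_psd b.
Proof.
move=> bcm p; rewrite {1}(poly_sum_Xn p) moment_functional_sqr.
pose u n := \sum_(i < size p) \sum_(j < size p)
  p`_i * p`_j * L b (bernstein_poly n.+1 (i + j)).
apply: (@cvgn_ge0 u).
  apply: cvgn_sum => i; apply: cvgn_sum => j; apply: cvgMl_tmp.
  rewrite -moment_functionalXn; apply: moment_functional_cvg.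
  exact: bernstein_poly_cvg.
move=> n; rewrite /u.
pose x (k : nat) : R := k%:R / n.+1%:R.
pose w (k : nat) := L b (((1 - 'X) ^+ (n.+1 - k) * 'X^k) *+ 'C(n.+1, k)).
have LE m : L b (bernstein_poly n.+1 m) = \sum_(k < n.+2) x k ^+ m * w k.
  by rewrite linear_sum; apply: eq_bigr => k _; rewrite linearZ.
have -> : \sum_(i < size p) \sum_(j < size p)
    p`_i * p`_j * L b (bernstein_poly n.+1 (i + j)) =
  \sum_(k < n.+2) w k * (\sum_(i < size p) p`_i * x k ^+ i) ^+ 2.
  transitivity (\sum_(i < size p) \sum_(j < size p) \sum_(k < n.+2)
      p`_i * p`_j * (x k ^+ (i + j) * w k)).
    by apply: eq_bigr => i _; apply: eq_bigr => j _; rewrite LE mulr_sumr.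
  under eq_bigr => i _ do rewrite exchange_big /=.
  rewrite exchange_big /=; apply: eq_bigr => k _.
  move: (w k) => wk; rewrite expr2 mulr_suml mulr_sumr; apply: eq_bigr => i _.
  rewrite mulr_sumr mulr_sumr; apply: eq_bigr => j _.
  by rewrite exprD; ring.
apply: sumr_ge0 => k _; rewrite mulr_ge0 ?sqr_ge0 // /w linearMn /=.
by rewrite mulrn_wge0 // moment_functional_bernstein; exact: bcm.
Qed.

End Bernstein.

Section ExpCM.
Variable R : realType.
Implicit Types (u v : R ^nat).

Lemma iter_nabla_cvg (f : nat -> R ^nat) u n k :
  (forall k, f m k @[m --> \oo] --> u k) ->
  iter n (@nabla R) (f m) k @[m --> \oo] --> iter n (@nabla R) u k.
Proof.
move=> fu; elim: n k => [|n IH] k //=; rewrite /nabla.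
by apply: cvgB; exact: IH.
Qed.

Lemma iter_nablaD n u v :
  iter n (@nabla R) (u + v) = iter n (@nabla R) u + iter n (@nabla R) v.
Proof.
elim: n => [//|n IH] /=; rewrite IH; apply/funext => k.
by rewrite /nabla !fctE opprD addrACA.
Qed.

Lemma iter_nablaZ n (a : R) u :
  iter n (@nabla R) (a *: u) = a *: iter n (@nabla R) u.
Proof.
elim: n => [//|n IH] /=; rewrite IH; apply/funext => k.
by rewrite /nabla !fctE scalerBr.
Qed.

Lemma iter_nabla_shift n u k :
  iter n (@nabla R) (fun k => u k.+1) k = iter n (@nabla R) u k.+1.
Proof. by elim: n u k => [//|n IH] u k; rewrite !iterSr -IH. Qed.

Lemma nablaM u v :
  nabla (u * v) = u * nabla v + nabla u * (fun k => v k.+1).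
Proof. by apply/funext => k; rewrite /nabla !fctE; ring. Qed.

Lemma n_monotoneM n u v : (forall m, (m <= n)%N -> n_monotone m u) ->
  (forall m, (m <= n)%N -> n_monotone m v) -> n_monotone n (u * v).
Proof.
elim: n u v => [|n IH] u v uP vP k.
  by rewrite /= fctE mulr_ge0 //; [exact: (uP 0%N)|exact: (vP 0%N)].
rewrite iterSr nablaM iter_nablaD fctE addr_ge0 //; apply: IH => m mn.
- exact/uP/leqW.
- by move=> j; rewrite -iterSr; exact: vP.
- by move=> j; rewrite -iterSr; exact: uP.
- by move=> j; rewrite iter_nabla_shift; apply: vP; exact: leqW.
Qed.

Lemma iter_nabla_cst n (a : R) k :
  iter n.+1 (@nabla R) (fun=> a) k = 0.
Proof.
rewrite iterSr.
have -> : nabla (fun=> a) = 0 *: (fun=> a).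
  by rewrite scale0r; apply/funext => j; rewrite /nabla subrr.
by rewrite iter_nablaZ scale0r.
Qed.

(** Order 0 is included, so [n_monotoneM] applies to the powers of [u]; the partial sums of the
    exponential series are then monotone of every order, and so is their limit. *)
Lemma n_monotone_expR u n : (forall m, n_monotone m u) ->
  n_monotone n (fun k => expR (u k)).
Proof.
move=> uP k; apply: (@cvgn_ge0 _ (fun N =>
  iter n (@nabla R) (fun k => series (exp_coeff (u k)) N) k)).
  by apply: iter_nabla_cvg => j; exact: is_cvg_series_exp_coeff.
move=> N; rewrite (_ : (fun k => _) = \sum_(i < N) i`!%:R^-1 *: u ^+ i).
  elim: N => [|N IH].
    by rewrite big_ord0 -(scale0r u) iter_nablaZ scale0r.
  rewrite big_ord_recr /= iter_nablaD iter_nablaZ addrfctE scalrfctE addr_ge0 //.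
  rewrite mulr_ge0 ?invr_ge0 //.
  elim: N n k {IH} => [|N IH] [|n] k.
  - by rewrite expr0 /= ler01.
  - by rewrite expr0 (iter_nabla_cst n 1).
  - by rewrite exprS; apply: n_monotoneM => m _ // j; exact: IH.
  - by rewrite exprS; apply: n_monotoneM => m _ // j; exact: IH.
apply/funext => j; rewrite /series /= big_mkord fct_sumE; apply: eq_bigr => i _.
by rewrite /exp_coeff /= !fctE mulrC.
Qed.

(* [nabla (exp u) k = exp (u (k+1)) (exp (nabla u k) - 1)], where [nabla u] is
   completely monotone including order [0]. *)
Lemma cm_expR u n : completely_monotone u -> n_monotone n (fun k => expR (u k)).
Proof.
move=> uP; elim/ltn_ind: n => -[_ k|n IH k]; first exact: expR_ge0.
rewrite iterSr (_ : nabla _ = (fun k => expR (u k.+1)) *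
  ((fun k => expR (nabla u k)) + (fun=> -1))); last first.
  by apply/funext => j; rewrite /nabla !fctE mulrBr mulr1 -expRD [u j.+1 + _]addrC subrK.
apply: n_monotoneM => m mn j.
  by rewrite (iter_nabla_shift _ (fun k => expR (u k))); exact: IH.
have nuP i : n_monotone i (nabla u) by move=> l; rewrite -iterSr; exact: uP.
(* The constant [-1] counts only at order 0, where it is absorbed by exp (nabla u) >= 1; higher
   differences kill it. *)
rewrite iter_nablaD fctE; case: m mn => [|m] mn.
  rewrite /= subr_ge0 -[leLHS]expR0 ler_expR; exact: (nuP 0%N).
by rewrite iter_nabla_cst addr0; exact: n_monotone_expR.
Qed.

End ExpCM.

(** * Hankel matrices *)

Section HankelMatrices.
Variable R : realType.
Implicit Types (b : R ^nat) (p : {poly R}).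
Local Notation L := moment_functional.

(** The mixed terms in real and imaginary parts cancel by symmetry of [A], which reduces positivity
    on complex vectors to real ones. *)
Lemma quadratic_form_complex (I : finType) (P : pred I) (A : I -> I -> R)
    (c : I -> R[i]) : (forall i j, A i j = A j i) ->
  \sum_(i | P i) \sum_(j | P j) (A i j)%:C%C * conjC (c i) * c j =
  (\sum_(i | P i) \sum_(j | P j) complex.Re (c i) * complex.Re (c j) * A i j
   + \sum_(i | P i) \sum_(j | P j) complex.Im (c i) * complex.Im (c j) * A i j)%:C%C.
Proof.
move=> Asym; pose x i := complex.Re (c i); pose y i := complex.Im (c i).
transitivity (\sum_(i | P i) \sum_(j | P j)
    ((x i * x j * A i j + y i * y j * A i j)%:C%C +
     ('i%C * (x i * y j * A i j)%:C%C - 'i%C * (x j * y i * A j i)%:C%C))).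
  apply: eq_bigr => i _; apply: eq_bigr => j _; rewrite (Asym j i) /x /y.
  case: (c i) (c j) => [a b] [a' b'] /=.
  by apply/eqP; rewrite eq_complex /=; apply/andP; split; apply/eqP; ring.
under eq_bigr do rewrite big_split sumrB /=.
rewrite big_split sumrB /= [X in _ + (_ - X)]exchange_big subrr addr0.
rewrite -big_split rmorph_sum /=; apply: eq_bigr => i _.
by rewrite -big_split rmorph_sum.
Qed.

Lemma principal_submx_herm (M : nat -> nat -> R) n (s : 'I_n -> nat) :
  (forall i j, M i j = M j i) -> principal_submx M s \is hermsymmx.
Proof.
move=> Msym; apply/is_hermitianmxP/matrixP => i j.
rewrite expr0 scale1r !mxE (Msym (s j)); apply/eqP.
by rewrite eq_complex /= oppr0 !eqxx.
Qed.

Lemma posdefmx_quadratic n (A : 'M[R[i]]_n) (v : 'cV[R[i]]_n) :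
  ((v ^t conjC)%sesqui *m A *m v) 0 0 =
  \sum_i \sum_j A i j * conjC (v i 0) * v j 0.
Proof.
rewrite mxE exchange_big; apply: eq_bigr => j _.
rewrite mxE mulr_suml; apply: eq_bigr => i _; rewrite !mxE.
by rewrite [A i j * _]mulrC.
Qed.

Lemma sumXn_horner1 (I : finType) (x : I -> R) (m : I -> nat) :
  (\sum_i x i *: 'X^(m i)).[1] = \sum_i x i.
Proof.
rewrite horner_sum; apply: eq_bigr => i _.
by rewrite hornerZ hornerXn expr1n mulr1.
Qed.

Lemma hankel_quadratic b n (s : 'I_n -> nat) (c : 'I_n -> R[i]) :
  \sum_i \sum_j principal_submx (fun i j => b (i + j)%N) s i j
    * conjC (c i) * c j =
  (L b ((\sum_i complex.Re (c i) *: 'X^(s i)) ^+ 2)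
   + L b ((\sum_i complex.Im (c i) *: 'X^(s i)) ^+ 2))%:C%C.
Proof.
rewrite !moment_functional_sqr.
rewrite -(@quadratic_form_complex _ xpredT (fun i j => b (s i + s j)%N)).
  by apply: eq_bigr => i _; apply: eq_bigr => j _; rewrite mxE.
by move=> i j; rewrite addnC.
Qed.

Lemma hankel_quadratic_poly b p :
  \sum_i \sum_j principal_submx (fun i j => b (i + j)%N)
    (fun i : 'I_(size p) => val i) i j * conjC (p`_i)%:C%C * (p`_j)%:C%C =
  (L b (p ^+ 2))%:C%C.
Proof.
rewrite hankel_quadratic /= -poly_sum_Xn.
rewrite [X in _ + L b (X ^+ 2)](_ : _ = 0).
  by rewrite expr0n /= linear0 addr0.
by rewrite big1 // => i _; rewrite scale0r.
Qed.

(** One way, the coefficients of [p] are tested on a leading block; the other way, a complex vector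
    yields two real polynomials with exponents [s i]. *)
Lemma inf_posdef_hankel b :
  inf_posdef (fun i j => b (i + j)%N) <-> hankel_psd b.
Proof.
split=> [bP p|bP n s _].
  have [_] := bP _ (fun i : 'I_(size p) => val i) (fun i j ij => ij).
  move=> /(_ (\col_i (p`_i)%:C%C)); rewrite posdefmx_quadratic.
  under eq_bigr do under eq_bigr do rewrite [X in conjC X]mxE [X in _ * X]mxE.
  by rewrite hankel_quadratic_poly ler0c.
split; first by apply: principal_submx_herm => i j; rewrite addnC.
by move=> v; rewrite posdefmx_quadratic hankel_quadratic ler0c addr_ge0.
Qed.

(** [p.[1]] is the sum of the coefficients of [p]. *)
Definition hankel_cpd b := forall p, p.[1] = 0 -> 0 <= L b (p ^+ 2).

Lemma inf_cpd_hankel b :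
  inf_cpd (fun i j => b (i + j)%N) <-> hankel_cpd b.
Proof.
split=> [bP p p1|bP n s _].
  have [_] := bP _ (fun i : 'I_(size p) => val i) (fun i j ij => ij).
  move=> /(_ (fun i => (p`_i)%:C%C)); rewrite hankel_quadratic_poly ler0c; apply.
  have sp : \sum_(i < size p) p`_i = p.[1].
    by rewrite horner_coef; apply: eq_bigr => i _; rewrite expr1n mulr1.
  by rewrite -rmorph_sum sp p1.
split; first by apply: principal_submx_herm => i j; rewrite addnC.
move=> c c0; rewrite hankel_quadratic ler0c addr_ge0 //; apply: bP.
  by rewrite sumXn_horner1 -(raddf_sum (@complex.Re R)) c0.
by rewrite sumXn_horner1 -(raddf_sum (@complex.Im R)) c0.
Qed.

(** Both bounds of the squeeze come from 1 + t <= exp t, taken at t = ln x / (n+1) and at its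
    opposite. *)
Lemma cvgn_powR_ln (x : R) : 0 < x ->
  n.+1%:R * (x `^ n.+1%:R^-1 - 1) @[n --> \oo] --> ln x.
Proof.
move=> x0; pose y := ln x.
have powE n : x `^ n.+1%:R^-1 = expR (y * n.+1%:R^-1).
  by rewrite /powR gt_eqF // mulrC.
under eq_fun do rewrite powE.
have n0 n : 0 < n.+1%:R :> R by rewrite ltr0n.
apply: (@squeeze_cvgr _ _ _ _ (fun=> y) (fun n => y * expR (y * n.+1%:R^-1))).
- apply: nearW => n; apply/andP; split.
    rewrite -ler_pdivrMl // lerBrDl mulrC; exact: expR_ge1Dx.
  rewrite -ler_pdivlMl // mulrA [_^-1 * y]mulrC; set t := y * _.
  have := expR_ge1Dx (- t); rewrite expRN => h.
  have e0 := expR_gt0 t.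
  have : (1 + - t) * expR t <= 1 by rewrite -ler_pdivlMr // mul1r.
  by rewrite mulrDl mul1r mulNr; lra.
- exact: cvg_cst.
- have ylim : y * expR (y * n.+1%:R^-1) @[n --> \oo] --> y * expR (y * 0).
    apply: cvgMl_tmp; apply: continuous_cvg; first exact: continuous_expR.
    by apply: cvgMl_tmp; exact: cvg_harmonic.
  by rewrite mulr0 expR0 mulr1 in ylim.
Qed.

(** Subtracting a constant sequence does not change the form on polynomials vanishing at 1, so (g^q
    - 1)/q inherits conditional positivity and passes it to the limit. *)
Lemma hankel_cpd_ln (g : R ^nat) : (forall k, 0 < g k) ->
  (forall q, 0 < q -> hankel_cpd (fun k => g k `^ q)) ->
  hankel_cpd (fun k => ln (g k)).
Proof.
move=> g0 gP p p1.
apply: (@cvgn_ge0 _ (fun n => L (fun k => n.+1%:R * (g k `^ n.+1%:R^-1 - 1)) (p ^+ 2))).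
  by apply: cvgn_sum => i; apply: cvgMl_tmp; exact: cvgn_powR_ln.
move=> n; rewrite (_ : L _ _ = n.+1%:R * (L (fun k => g k `^ n.+1%:R^-1) (p ^+ 2)
    - L (fun=> 1) (p ^+ 2))).
  rewrite moment_functional_cst horner_exp p1 expr0n mul0r subr0 mulr_ge0 //; exact: gP.
rewrite !moment_functionalE -sumrB mulr_sumr; apply: eq_bigr => i _; ring.
Qed.

(** Since (1 - X)p vanishes at 1, conditional positivity of [a] is positivity of its second
    difference. This settles the orders from 2 on; order 1 is assumed. *)
Lemma hankel_cpd_cm (a : R ^nat) : (forall k, 0 <= nabla a k) ->
  hankel_cpd a -> hankel_cpd (fun k => a k.+1) -> completely_monotone a.
Proof.
move=> a1 a0P a1P.
have psd c : hankel_cpd c -> hankel_psd (nabla (nabla c)).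
  move=> cP p; rewrite !moment_functional_nabla mulrA -expr2 -exprMn.
  by apply: cP; rewrite hornerM !hornerE subrr mul0r.
have b0P := psd _ a0P; have b1P := psd _ a1P.
have b0 k : 0 <= nabla (nabla a) k.
  exact: (hankel_psd_ge0 (hankel_psd_shift k b0P b1P)).
(* A nonnegative, nonincreasing [nabla a] bounds its own differences by its first term. *)
have dec k : nabla a k <= nabla a 0%N.
  elim: k => [//|k]; apply: le_trans.
  by have := b0 k; rewrite /(nabla (nabla a)) subr_ge0.
have bS : bounded_stieltjes (nabla (nabla a)).
  split => //; exists (nabla a 0%N) => k; rewrite ger0_norm //.
  by rewrite (le_trans _ (dec k)) // lerBlDr lerDl.
move=> [//|[|n]] _ k; first exact: a1.
by rewrite !iterSr; exact: bounded_stieltjes_cm.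
Qed.

Lemma completely_monotone_powR (g : R ^nat) (q : R) n : (forall k, 0 < g k) ->
  0 < q -> completely_monotone (fun k => ln (g k)) ->
  n_monotone n (fun k => g k `^ q).
Proof.
move=> g0 q0 gcm.
rewrite (_ : (fun k => _) = fun k => expR ((q *: (fun k => ln (g k))) k)).
  apply: cm_expR => m m1 k; rewrite iter_nablaZ mulr_ge0 ?(ltW q0) //.
  exact: gcm.
by apply/funext => k; rewrite /powR gt_eqF.
Qed.

End HankelMatrices.

(** * Operators on l^2 *)

Section L2Operators.
Variable R : realType.
Local Notation C := R[i].
Implicit Types (x y : l2 R) (K : hilbertType R).

Lemma hdot_le_norm K (u v : K) : `|hdot u v| <= `|u| * `|v|.
Proof.
apply: (le_trans (dot_norm_le_mul _ _ _)).
by rewrite /dot_norm -!hdotE !sqrCK.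
Qed.

Lemma l2_normE x : `|x| ^+ 2 = (limn (series (fun k => sqnormc (x k))))%:C%C.
Proof. by rewrite hdotE l2_hdotE l2dotxx. Qed.

Lemma cvgn_of_sqnorm (V : normedModType C) (u : nat -> V) (l : V) (r : R ^nat) :
  r @ \oo --> 0 -> (forall n, `|l - u n| ^+ 2 <= (r n)%:C%C) ->
  u @ \oo --> l.
Proof.
move=> r0 ur; apply/cvgrPdist_lt => e e0.
have eE : e = (complex.Re e)%:C%C by rewrite RRe_real ?gtr0_real.
have e0' : 0 < complex.Re e by rewrite -ltcR -eE.
have /cvgrPdist_lt/(_ _ (exprn_gt0 2 e0')) := r0.
apply: filterS => n; rewrite sub0r normrN => rn.
rewrite -(@ltr_pXn2r _ 2) ?nnegrE ?normr_ge0 ?(ltW e0) //.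
apply: (le_lt_trans (ur n)); rewrite eE -rmorphXn ltcR.
exact: le_lt_trans (ler_norm _) rn.
Qed.

Definition l2_trunc x n : l2 R := \sum_(k < n) x k *: l2_basis R k.

Lemma l2_truncE x n k : l2_trunc x n k = if (k < n)%N then x k else 0.
Proof.
elim: n => [|n IH]; first by rewrite /l2_trunc big_ord0.
rewrite /l2_trunc big_ord_recr -[LHS]/(l2_trunc x n k + x n * (k == n)%:R) IH.
by rewrite ltnS; case: ltngtP => [||->]; rewrite ?mulr0 ?mulr1 ?addr0 ?add0r.
Qed.

Lemma l2_trunc_cvg x : l2_trunc x @ \oo --> x.
Proof.
pose s := series (fun k => sqnormc (x k)).
have sx : cvgn s by exact: l2_summable.
apply: (@cvgn_of_sqnorm _ _ _ (fun n => limn s - s n)).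
  by rewrite -[X in _ --> X](subrr (limn s)); apply: cvgB => //; exact: cvg_cst.
move=> n; rewrite l2_normE lecR.
apply: limr_le; first exact: (@l2_summable _ (x - l2_trunc x n)).
exists n => // m /= nm; rewrite lerBrDr.
apply: le_trans (l2_partial_le x m); rewrite /series /=.
rewrite (big_cat_nat (leq0n n) nm) //= [X in _ <= X](big_cat_nat (leq0n n) nm) //=.
rewrite big_nat big1 ?add0r; last first.
  move=> k /andP[_ kn]; rewrite [X in sqnormc X](_ : _ = 0).
    by rewrite /sqnormc /= expr0n addr0.
  by rewrite -[LHS]/(x k - l2_trunc x n k) l2_truncE kn subrr.
rewrite [X in _ <= X]addrC /s /series /= lerD2r big_nat [X in _ <= X]big_nat.
rewrite le_eqVlt; apply/orP; left; apply/eqP.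
apply: eq_bigr => k /andP[nk _]; congr sqnormc.
by rewrite -[LHS]/(x k - l2_trunc x n k) l2_truncE ltnNge nk subr0.
Qed.

(** Truncations are dense by [l2_trunc_cvg], so identities between bounded linear maps can be
    checked on the basis. *)
Lemma l2_bounded_linear_eq0 (W : normedModType C) (f : l2 R -> W) (M : C) :
  linear f -> 0 <= M -> (forall x, `|f x| <= M * `|x|) ->
  (forall k, f (l2_basis R k) = 0) -> forall x, f x = 0.
Proof.
move=> flin M0 fM fe x.
pose F : {linear l2 R -> W} := HB.pack f (GRing.isLinear.Build _ _ _ _ f flin).
have ft n : f (l2_trunc x n) = 0.
  rewrite -[LHS]/(F _) linear_sum big1 // => k _.
  by rewrite linearZ /= fe scaler0.
apply/eqP; rewrite -normr_eq0 eq_le normr_ge0 andbT.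
apply/ler_addgt0Pr => e e0; rewrite add0r.
(* Dividing by [M + 1] covers the case [M = 0]. *)
have d0 : 0 < e / (M + 1) by rewrite divr_gt0 // ltr_wpDl.
have /cvgrPdist_lt/(_ _ d0)[n _ /(_ _ (leqnn n)) nP] := @l2_trunc_cvg x.
have -> : f x = f (x - l2_trunc x n).
  by rewrite -[RHS]/(F _) linearB -[F (l2_trunc _ _)]/(f _) ft subr0.
apply: (le_trans (fM _)).
apply: (@le_trans _ _ (M * (e / (M + 1)))); first by rewrite ler_wpM2l // ltW.
rewrite mulrCA ler_piMr ?(ltW e0) // ler_pdivrMr ?mul1r ?lerDl //.
by rewrite ltr_wpDl.
Qed.

(** The linear case is used in each variable in turn; conjugation makes the second one linear. *)
Lemma l2_sesquilinear_eq0 (F : l2 R -> l2 R -> C) (M : C) :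
  0 <= M -> (forall y, linear (fun x => F x y : C^o)) ->
  (forall x, linear (fun y => conjC (F x y) : C^o)) ->
  (forall x y, `|F x y| <= M * `|x| * `|y|) ->
  (forall m n, F (l2_basis R m) (l2_basis R n) = 0) -> forall x y, F x y = 0.
Proof.
move=> M0 Fl Fr FM Fe x y.
apply: (@l2_bounded_linear_eq0 C^o (fun x => F x y) (M * `|y|) (Fl y)).
- by rewrite mulr_ge0.
- by move=> z; rewrite mulrAC; exact: FM.
move=> k; apply: (can_inj conjCK); rewrite rmorph0.
apply: (@l2_bounded_linear_eq0 C^o (fun y => conjC (F (l2_basis R k) y))
  (M * `|l2_basis R k|) (Fr _)).
- by rewrite mulr_ge0.
- by move=> z; rewrite norm_conjC; exact: FM.
- by move=> n; rewrite Fe rmorph0.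
Qed.

(** The image of [x] is the limit of the partial sums of the x_k t_k. By hypothesis their
    differences are controlled by tails of the series of the |x_k|^2, so they are Cauchy. *)
Lemma l2_contraction_ext K (t : nat -> K) :
  (forall n (c : nat -> C),
     `|\sum_(k < n) c k *: t k| ^+ 2 <= \sum_(k < n) `|c k| ^+ 2) ->
  exists T : {linear l2 R -> K},
    (forall k, T (l2_basis R k) = t k) /\ forall x, `|T x| <= `|x|.
Proof.
move=> tP.
pose s x n : K := \sum_(k < n) x k *: t k.
have s_cvg x : cvgn (s x).
  apply/cauchy_cvgP/cauchy_exP => e e0.
  have eE : e = (complex.Re e)%:C%C by rewrite RRe_real ?gtr0_real.
  have e0' : 0 < complex.Re e by rewrite -ltcR -eE.
  pose S := series (fun k => sqnormc (x k)).
  have /cvgrPdist_lt/(_ _ (exprn_gt0 2 e0'))[N _ NP] : S @ \oo --> limn S.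
    exact: l2_summable.
  exists (s x N); exists N => // n /= Nn; rewrite -ball_normE /ball_ /= distrC.
  rewrite -(@ltr_pXn2r _ 2) ?nnegrE ?normr_ge0 ?(ltW e0) //.
  have -> : s x n - s x N =
      \sum_(k < n) (if (k < N)%N then 0 else x k) *: t k.
    rewrite /s (big_ord_widen n (fun k => x k *: t k) Nn) [X in _ - X]big_mkcond.
    rewrite -sumrB; apply: eq_bigr => k _.
    by case: ltnP => _; rewrite ?subrr ?scale0r ?subr0.
  apply: (le_lt_trans (tP n (fun k => if (k < N)%N then 0 else x k))).
  apply: (@le_lt_trans _ _ ((limn S - S N)%:C%C)); last first.
    rewrite eE -rmorphXn ltcR; apply: le_lt_trans (NP N _) => //=.
    exact: ler_norm.
  have -> : \sum_(k < n) `|if (k < N)%N then 0 else x k| ^+ 2 = (S n - S N)%:C%C.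
    rewrite /S /series /= !big_mkord.
    rewrite (big_ord_widen n (fun k => sqnormc (x k)) Nn) [X in _ - X]big_mkcond.
    rewrite -sumrB rmorph_sum; apply: eq_bigr => k _ /=.
    by case: ltnP => _; rewrite ?normr0 ?expr0n ?subrr ?subr0 ?sqnormcE.
  by rewrite lecR lerD2r; exact: l2_partial_le.
pose T x : K := limn (s x).
have TP x : s x @ \oo --> T x by exact: s_cvg.
have K_haus : hausdorff_space K by exact: norm_hausdorff.
have Tlin : linear T.
  move=> a x y; apply: (cvg_lim K_haus).
  rewrite (_ : s _ = (fun n => a *: s x n + s y n)).
    by apply: cvgD => //; apply: cvgZl_tmp.
  apply/funext => n; rewrite /s scaler_sumr -big_split /=; apply: eq_bigr => k _.
  by rewrite scalerA -scalerDl.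
pose T' : {linear l2 R -> K} :=
  HB.pack T (GRing.isLinear.Build _ _ _ _ T Tlin).
exists T'; split => [k|x] /=.
  apply: (cvg_lim K_haus); apply: cvg_near_cst; exists k.+1 => // n /= kn.
  rewrite /s (bigD1 (Ordinal kn)) //= eqxx scale1r big1 ?addr0 // => i ik.
  rewrite [_ == _](_ : _ = false) ?scale0r //; apply/negP => /eqP ki.
  by case/eqP: ik; apply/val_inj.
apply/ler_addgt0Pr => e e0.
have /cvgrPdist_lt/(_ _ e0)[n _ /(_ _ (leqnn n)) nP] := TP x.
rewrite -[T x](subrK (s x n)) addrC (le_trans (ler_normD _ _)) // lerD ?(ltW nP) //.
rewrite -(@ler_pXn2r _ 2) ?nnegrE ?normr_ge0 // (le_trans (tP _ _)) // l2_normE.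
under eq_bigr do rewrite -sqnormcE.
by rewrite -rmorph_sum lecR -(big_mkord xpredT (fun k => sqnormc (x k)));
  exact: l2_partial_le.
Qed.

Lemma contraction_continuous K K' (T : {linear K -> K'}) :
  (forall u, `|T u| <= `|u|) -> continuous T.
Proof.
move=> TP u; apply/(@cvgrPdist_lt _ _ _ (nbhs u)) => e e0; near=> z.
rewrite -linearB (le_lt_trans (TP _)) //; near: z.
Unshelve. all: by end_near. Qed.

Lemma l2dot_finite x y n : (forall k, (n <= k)%N -> x k = 0) ->
  l2dot x y = \sum_(k < n) x k * conjC (y k).
Proof.
move=> xn; rewrite /l2dot /csum.
have E (f : C -> R) : f 0 = 0 -> limn (series (fun k => f (x k * conjC (y k)))) =
    \sum_(k < n) f (x k * conjC (y k)).
  move=> f0; apply: (cvg_lim (@Rhausdorff R)); apply: cvg_near_cst.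
  exists n => // m /= nm; rewrite /series /= (big_cat_nat (leq0n n) nm) //=.
  rewrite [X in _ + X]big_nat [X in _ + X]big1 ?addr0 ?big_mkord //.
  by move=> k /andP[nk _]; rewrite xn // mul0r.
rewrite !E //; apply/eqP; rewrite eq_complex /=.
by rewrite -!raddf_sum !eqxx.
Qed.

Lemma hdot_basis x n : hdot x (l2_basis R n) = x n.
Proof.
rewrite l2_hdotE l2dot_conj (@l2dot_finite _ _ n.+1); last by move=> k kn; rewrite /= gtn_eqF.
rewrite big_ord_recr /= eqxx mul1r big1 ?add0r ?conjCK // => k _.
by rewrite ltn_eqF // mul0r.
Qed.

End L2Operators.

(** * Gram-Schmidt and normal dilations *)

Section GramSchmidt.
Variables (C : numClosedFieldType) (E : lmodType C) (B : E -> E -> C).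
Hypothesis B_lin : forall q, scalar (B ^~ q).
Hypothesis B_sym : forall p q, B q p = conjC (B p q).
Hypothesis B_ge0 : forall p, 0 <= B p p.
Implicit Types (p q : E).

Let Bl q : {scalar E} := HB.pack (B ^~ q)
  (GRing.isLinear.Build _ _ _ _ (B ^~ q) (B_lin q)).

Lemma formDl p1 p2 q : B (p1 + p2) q = B p1 q + B p2 q.
Proof. exact: (linearD (Bl q)). Qed.

Lemma formBl p1 p2 q : B (p1 - p2) q = B p1 q - B p2 q.
Proof. exact: (linearB (Bl q)). Qed.

Lemma formZl a p q : B (a *: p) q = a * B p q.
Proof. by rewrite -[LHS]/(Bl q _) linearZ. Qed.

Lemma form_suml (I : Type) (r : seq I) (P : pred I) (F : I -> E) q :
  B (\sum_(i <- r | P i) F i) q = \sum_(i <- r | P i) B (F i) q.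
Proof. exact: (linear_sum (Bl q)). Qed.

Lemma formBr p q1 q2 : B p (q1 - q2) = B p q1 - B p q2.
Proof. by rewrite B_sym formBl rmorphB /= -!B_sym. Qed.

Lemma formZr a p q : B p (a *: q) = conjC a * B p q.
Proof. by rewrite B_sym formZl rmorphM /= -!B_sym. Qed.

(** Moving [q] along a null vector [p] changes [B q q] only linearly, so if [B p q] were nonzero
    some choice of [t] would bring the form down to -1. *)
Lemma form_null p q : B p p = 0 -> B p q = 0.
Proof.
move=> p0; apply/eqP; rewrite -normr_eq0; apply/negPn/negP => pq0.
have n0 : 0 < `|B p q| ^+ 2 by rewrite exprn_gt0 // normr_gt0 -normr_eq0.
have [t t0 tE] : exists2 t, 0 <= t & t * (2 * `|B p q| ^+ 2) = B q q + 1.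
  exists ((B q q + 1) / (2 * `|B p q| ^+ 2)).
    by rewrite divr_ge0 ?addr_ge0 ?mulr_ge0 ?(ltW n0).
  by rewrite mulfVK // mulf_neq0 ?pnatr_eq0 ?gt_eqF.
have := B_ge0 (q - (t * conjC (B p q)) *: p).
rewrite formBl !formBr !formZl !formZr p0 !mulr0 subr0 (B_sym p q).
have tC : conjC t = t by apply/CrealP; rewrite ger0_real.
rewrite !rmorphM /= conjCK tC.
have -> : B q q - t * B p q * conjC (B p q) - t * conjC (B p q) * B p q =
    B q q - t * (2 * `|B p q| ^+ 2) by rewrite normCK; ring.
by rewrite tE opprD addNKr ler0N1.
Qed.

Variable e : nat -> E.

Definition gs_residue (s : seq E) n : E := e n - \sum_(P <- s) B (e n) P *: P.

(* Null vectors are sent to [0], since [sqrtC 0] has inverse [0]. *)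
Definition gs_normalize (r : E) : E := (sqrtC (B r r))^-1 *: r.

Fixpoint gs_seq n : seq E :=
  if n is m.+1 then rcons (gs_seq m) (gs_normalize (gs_residue (gs_seq m) m))
  else [::].

Definition gs n : E := gs_normalize (gs_residue (gs_seq n) n).

Lemma gs_seqE n : gs_seq n = map gs (iota 0 n).
Proof.
elim: n => [//|n IH]; rewrite -[in RHS]addn1 iotaD map_cat /= add0n cats1 -IH.
by [].
Qed.

Lemma gs_residueE n :
  gs_residue (gs_seq n) n = e n - \sum_(k < n) B (e n) (gs k) *: gs k.
Proof.
rewrite /gs_residue gs_seqE big_map.
by rewrite -(big_mkord xpredT (fun k => B (e n) (gs k) *: gs k)) /index_iota subn0.
Qed.

Lemma gs_normalize_norm r : B (gs_normalize r) (gs_normalize r) = (B r r != 0)%:R.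
Proof.
rewrite formZl formZr; have [->|r0] := eqVneq (B r r) 0; first by rewrite !mulr0.
have sr : 0 < sqrtC (B r r) by rewrite sqrtC_gt0 lt_neqAle eq_sym r0 B_ge0.
rewrite (CrealP _) ?rpredV ?gtr0_real // mulrA -{3}[B r r]sqrtCK.
by rewrite -expr2 -exprMn mulVf ?expr1n // gt_eqF.
Qed.

Lemma gs_norm n : B (gs n) (gs n) = (B (gs n) (gs n) != 0)%:R.
Proof.
rewrite /gs gs_normalize_norm; case: (_ != _); first by rewrite oner_neq0.
by rewrite eqxx.
Qed.

(** The equality r = B(r, r') r', with r' the normalization of [r], may fail for a null [r], but
    always holds up to a null vector. *)
Lemma gs_normalize_expand r : B (r - B r (gs_normalize r) *: gs_normalize r)
  (r - B r (gs_normalize r) *: gs_normalize r) = 0.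
Proof.
have [r0|r0] := eqVneq (B r r) 0.
  by rewrite /gs_normalize r0 sqrtC0 invr0 !scale0r scaler0 subr0.
have sr : 0 < sqrtC (B r r) by rewrite sqrtC_gt0 lt_neqAle eq_sym r0 B_ge0.
rewrite /gs_normalize; set s := sqrtC _ in sr *.
have sE : B r r = s ^+ 2 by rewrite sqrtCK.
rewrite formZr scalerA (CrealP _) ?rpredV ?gtr0_real // sE.
have -> : s^-1 * s ^+ 2 / s = 1 by field; rewrite gt_eqF.

by rewrite scale1r subrr -(scale0r r) formZl mul0r.
Qed.

Lemma gs_orth m n : m != n -> B (gs m) (gs n) = 0.
Proof.
wlog mn : m n / (m < n)%N => [H|_].
  rewrite neq_ltn => /orP[mn|nm]; first by rewrite H // neq_ltn mn.
  by rewrite B_sym H ?rmorph0 // neq_ltn nm.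
elim/ltn_ind: n m mn => n IH m mn.
have IHs i j : (i < n)%N -> (j < n)%N -> i != j -> B (gs i) (gs j) = 0.
  move=> in_ jn; rewrite neq_ltn => /orP[ij|ji]; first exact: IH.
  by rewrite B_sym IH ?rmorph0.
rewrite B_sym formZl; move: (sqrtC _)^-1 => s; rewrite gs_residueE formBl form_suml (bigD1 (Ordinal mn)) //=.
rewrite [X in _ - (_ + X)]big1; last first.
  move=> k km; rewrite formZl IHs ?mulr0 //.
(* A null [gs m] is orthogonal to everything; otherwise its square norm is 1 and the projection
   cancels exactly. *)
rewrite addr0 formZl gs_norm; have [m0|_] := eqVneq (B (gs m) (gs m)) 0.
  by rewrite B_sym form_null // rmorph0 mul0r subr0 mulr0 rmorph0.
by rewrite mulr1 subrr mulr0 rmorph0.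
Qed.

(** A finite Parseval identity. It expresses that [p] is a combination of the [gs k] up to a null
    vector. *)
Definition gs_expansion p := exists n, (forall k, (n <= k)%N -> B p (gs k) = 0) /\
  forall q, B p q = \sum_(k < n) B p (gs k) * B (gs k) q.

(** Up to a null vector, which [form_null] discards, the residue of [e n] is its projection on
    [gs n]; the rest of [e n] was subtracted along the earlier vectors. *)
Lemma gs_expansion_basis n : gs_expansion (e n).
Proof.
have eE q : B (e n) q = \sum_(k < n.+1) B (e n) (gs k) * B (gs k) q.
  have := form_null q (gs_normalize_expand (gs_residue (gs_seq n) n)).
  rewrite -/(gs n) formBl => /eqP; rewrite subr_eq0 => /eqP.
  have rE : B (gs_residue (gs_seq n) n) (gs n) = B (e n) (gs n).
    rewrite gs_residueE formBl form_suml big1 ?subr0 // => k _.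
    by rewrite formZl gs_orth ?mulr0 // ltn_eqF.
  rewrite formZl rE gs_residueE formBl form_suml => /eqP; rewrite subr_eq => /eqP ->.
  rewrite big_ord_recr addrC /=; congr (_ + _).
  by apply: eq_bigr => k _; rewrite formZl.
exists n.+1; split => // k nk; rewrite eE big1 // => j _.
by rewrite gs_orth ?mulr0 // ltn_eqF // (leq_trans (ltn_ord j)).
Qed.

Lemma gs_expansion_linear a p q :
  gs_expansion p -> gs_expansion q -> gs_expansion (a *: p + q).
Proof.
move=> [m [m0 mE]] [n [n0 nE]]; exists (maxn m n); split.
  move=> k; rewrite geq_max => /andP[mk nk].
  by rewrite formDl formZl m0 // n0 // mulr0 addr0.
have widen N r : (forall k, (N <= k)%N -> B r (gs k) = 0) -> (N <= maxn m n)%N ->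
    forall u, \sum_(k < N) B r (gs k) * B (gs k) u =
    \sum_(k < maxn m n) B r (gs k) * B (gs k) u.
  move=> r0 Nn u.
  rewrite (big_ord_widen _ (fun k => B r (gs k) * B (gs k) u) Nn) big_mkcond.
  by apply: eq_bigr => k _; case: ltnP => // /r0 ->; rewrite mul0r.
move=> u; rewrite formDl formZl mE nE (widen _ _ m0) ?leq_maxl //.
rewrite (widen _ _ n0) ?leq_maxr // mulr_sumr -big_split; apply: eq_bigr => k _.
by rewrite formDl formZl mulrDl mulrA.
Qed.

End GramSchmidt.

Section Dilation.
Variable R : realType.
Local Notation C := R[i].
Variables (E : lmodType C) (B : E -> E -> C).
Hypothesis B_lin : forall q, scalar (B ^~ q).
Hypothesis B_sym : forall p q, B q p = conjC (B p q).
Hypothesis B_ge0 : forall p, 0 <= B p p.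
Variable e : nat -> E.
Hypothesis e_span : forall p, exists n (c : nat -> C), p = \sum_(k < n) c k *: e k.
Implicit Types (p q : E).

Local Notation P := (gs B e).

Lemma gs_expand p : gs_expansion B e p.
Proof.
have [n [c ->]] := e_span p; elim: n => [|n IH].
  rewrite big_ord0; exists 0%N; split=> [k _|q].
    by rewrite -(scale0r 0) (formZl B_lin) mul0r.
  by rewrite big_ord0 -(scale0r 0) (formZl B_lin) mul0r.
rewrite big_ord_recr /= addrC; apply: gs_expansion_linear => //.
exact: gs_expansion_basis.
Qed.

Fact gs_coord_l2 p : (fun n => B p (P n) : C^o) \in @l2_pred R.
Proof.
have [n [n0 _]] := gs_expand p; apply/l2P.
apply: (square_summable_bound (B := \sum_(k < n) sqnormc (B p (P k)))) => N.
rewrite /series /= big_mkord; case: (leqP N n) => Nn.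
  rewrite (big_ord_widen n (fun k => sqnormc (B p (P k))) Nn) big_mkcond /=.
  by apply: ler_sum => k _; case: ifP => // _; exact: sqnormc_ge0.
rewrite (big_ord_widen N (fun k => sqnormc (B p (P k))) (ltnW Nn)).
rewrite [leRHS]big_mkcond /=; apply: ler_sum => k _; case: ltnP => // /n0 ->.
by rewrite /sqnormc /= expr0n addr0.
Qed.

Definition gs_coord p : l2 R := L2 (gs_coord_l2 p).

Lemma gs_coord_linear : linear gs_coord.
Proof.
move=> a p q; apply: val_inj; apply/funext => n.
exact: B_lin.
Qed.

HB.instance Definition _ := GRing.isLinear.Build C E (l2 R) _ gs_coord
  gs_coord_linear.

Lemma gs_coord_dot p q : hdot (gs_coord p) (gs_coord q) = B p q.
Proof.
have [n [n0 ->]] := gs_expand p.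
rewrite l2_hdotE (@l2dot_finite _ _ _ n) //; apply: eq_bigr => k _.
by rewrite /= -B_sym.
Qed.

Lemma gs_coord_norm p : `|gs_coord p| ^+ 2 = B p p.
Proof. by rewrite hdotE gs_coord_dot. Qed.

(** The [P k] are orthogonal with square norm 0 or 1; those of norm 0 make this an inequality. *)
Lemma gs_combination_norm n (c : nat -> C) :
  B (\sum_(k < n) c k *: P k) (\sum_(k < n) c k *: P k) <= \sum_(k < n) `|c k| ^+ 2.
Proof.
rewrite (form_suml B_lin); apply: ler_sum => k _.
rewrite (formZl B_lin) B_sym (form_suml B_lin) (bigD1 k) //=.
rewrite big1 ?addr0; last first.
  by move=> j jk; rewrite (formZl B_lin) gs_orth ?mulr0.
rewrite (formZl B_lin) gs_norm // rmorphM /= conjC_nat mulrA -normCK.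
by rewrite ler_piMr ?exprn_ge0 // lern1; case: (_ != _).
Qed.

Section Operator.
Variables (X : {linear E -> E}).
Hypothesis X_contr : forall p, B (X p) (X p) <= B p p.

(** The basis vector [l2_basis R k] stands for [P k]; a null [P k] is 0, and the basis vector is
    then sent to 0. *)
Lemma gs_operator : exists T : {linear l2 R -> l2 R},
  [/\ forall k, T (l2_basis R k) = gs_coord (X (P k)),
      forall p, T (gs_coord p) = gs_coord (X p) & forall x, `|T x| <= `|x|].
Proof.
have [|T [TP Tc]] := @l2_contraction_ext R (l2 R) (fun k => gs_coord (X (P k))).
  move=> n c; rewrite [X in `|X|](_ : _ = gs_coord (X (\sum_(k < n) c k *: P k))).
    rewrite gs_coord_norm; apply: le_trans (X_contr _) _; exact: gs_combination_norm.
  rewrite !linear_sum; apply: eq_bigr => k _.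
  by rewrite [X (c k *: _)]linearZ /= [gs_coord (c k *: _)]linearZ.
exists T; split => // p; have [n [n0 nE]] := gs_expand p.
have -> : gs_coord p = \sum_(k < n) B p (P k) *: l2_basis R k.
  rewrite -[RHS]/(l2_trunc (gs_coord p) n); apply: val_inj; apply/funext => k.
  by rewrite /= l2_truncE; case: ltnP => [//|/n0 ->//].
rewrite linear_sum; pose p' := \sum_(k < n) B p (P k) *: P k.
transitivity (gs_coord (X p')).
  rewrite !linear_sum; apply: eq_bigr => k _.
  rewrite [T _]linearZ /= TP [X (B p (P k) *: _)]linearZ /=.
  by rewrite [gs_coord (B p (P k) *: _)]linearZ.
(* [p - p'] is null for [B], and [X] keeps it null because it does not increase the form. *)
apply/eqP; rewrite eq_sym -subr_eq0 -!linearB -normr_eq0 -sqrf_eq0 gs_coord_norm.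
rewrite eq_le B_ge0 andbT (le_trans (X_contr _)) //.
rewrite (formBl B_lin) nE (form_suml B_lin); under [X in _ - X]eq_bigr do rewrite (formZl B_lin).
by rewrite subrr.
Qed.

End Operator.

(** Adjointness and commutation give B(Yp, Yp) = B(Xp, Xp), so [X] and [Y] both extend to
    contractions of l^2. Their adjointness and commutation there are verified on the basis. *)
Theorem normal_dilation (X Y : {linear E -> E}) :
  (forall p q, B (X p) q = B p (Y q)) -> (forall p, X (Y p) = Y (X p)) ->
  (forall p, B (X p) (X p) <= B p p) ->
  exists (phi : {linear E -> l2 R}) (N : {linear l2 R -> l2 R}),
    [/\ forall p q, hdot (phi p) (phi q) = B p q, normal_operator N,
        forall x, `|N x| <= `|x| & forall p, N (phi p) = phi (X p)].
Proof.
move=> XY XYC Xc.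
have Yc p : B (Y p) (Y p) <= B p p by rewrite -XY XYC B_sym -XY -B_sym.
have [N [Ne NP Nc]] := gs_operator Xc; have [S [Se SP Sc]] := gs_operator Yc.
exists gs_coord, N; split => //; first exact: gs_coord_dot.
split; first exact: contraction_continuous.
exists S.
  move=> x y; apply/eqP; rewrite -subr_eq0; apply/eqP; move: x y.
  apply: (@l2_sesquilinear_eq0 R (fun x y => hdot (N x) y - hdot x (S y)) 2) => //.
  - move=> y a u v; rewrite !linearP !linearPl /=.
    by rewrite -[a *: _]/(a * _); ring.
  - move=> x a u v; rewrite [S _]linearP !linearPr /= !rmorphB !rmorphD !rmorphM /= !conjCK.
    by rewrite -[a *: _]/(a * _); ring.
  - move=> x y; rewrite (le_trans (ler_normB _ _)) // -mulrA mulr_natl mulr2n.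
    apply: lerD; apply: (le_trans (hdot_le_norm _ _)).
      by rewrite ler_wpM2r ?normr_ge0 ?Nc.
    by rewrite ler_wpM2l ?normr_ge0 ?Sc.
  - move=> m n; rewrite Ne Se [X in _ - X]hermC /= expr0 mul1r.
    rewrite !hdot_basis /= XY.
    by rewrite [X in _ - X](_ : _ = B (P m) (Y (P n))) ?subrr // -B_sym.
move=> x; apply/eqP; rewrite -subr_eq0; apply/eqP; move: x.
apply: (@l2_bounded_linear_eq0 R (l2 R) (fun x => N (S x) - S (N x)) 2) => //.
- by move=> a u v; rewrite !linearP /= scalerBr addrACA scalerN.
- move=> x; rewrite (le_trans (ler_normB _ _)) // mulr_natl mulr2n lerD //.
    exact: le_trans (Nc _) (Sc _).
  exact: le_trans (Sc _) (Nc _).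
- by move=> k; rewrite Ne Se NP SP XYC subrr.
Qed.

End Dilation.

(** * Subnormality from Hankel positivity *)

Section KernelDilation.
Variable R : realType.
Local Notation C := R[i].
Implicit Types (kappa : nat -> nat -> R) (p q : {poly C}).

Definition kernel_psd kappa := forall n (x : nat -> R),
  0 <= \sum_(i < n) \sum_(j < n) x i * x j * kappa i j.

(** Here ['X^i] is a formal vector of index [i], and the form is the sesquilinear extension of
    [kappa]. *)
Definition kernel_form kappa p q : C :=
  poly_ext (fun i => conjC (poly_ext (fun j => (kappa i j)%:C%C : C^o) q) : C^o) p.

Lemma kernel_formE kappa p q : kernel_form kappa p q =
  \sum_(i < size p) \sum_(j < size q) p`_i * conjC q`_j * (kappa i j)%:C%C.
Proof.
apply: eq_bigr => i _; rewrite [X in conjC X]/poly_ext rmorph_sum scaler_sumr.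
apply: eq_bigr => j _; rewrite rmorphM /= -mulrA; congr (_ * (_ * _)).
by apply/CrealP; rewrite complex_real.
Qed.

Lemma kernel_form_linear kappa q : scalar (kernel_form kappa ^~ q).
Proof. exact: poly_ext_linear. Qed.

Lemma kernel_form_sym kappa p q : (forall i j, kappa i j = kappa j i) ->
  kernel_form kappa q p = conjC (kernel_form kappa p q).
Proof.
move=> ks; rewrite !kernel_formE rmorph_sum exchange_big; apply: eq_bigr => i _.
rewrite rmorph_sum; apply: eq_bigr => j _; rewrite !rmorphM /= conjCK.
rewrite [q`_j * _]mulrC ks; congr (_ * _).
by apply/esym/CrealP; rewrite complex_real.
Qed.

Lemma kernel_form_ge0 kappa p : (forall i j, kappa i j = kappa j i) ->
  kernel_psd kappa -> 0 <= kernel_form kappa p p.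
Proof.
move=> ks kp; rewrite kernel_formE exchange_big.
have := @quadratic_form_complex R _ xpredT (fun i j : 'I_(size p) => kappa i j)
  (fun i => p`_i) (fun i j => ks i j).
rewrite (_ : \sum_i _ = \sum_(j < size p) \sum_(i < size p)
    p`_i * conjC p`_j * (kappa i j)%:C%C) => [->|].
  by rewrite ler0c addr_ge0 //; [exact: (kp _ (fun i => complex.Re p`_i))|
    exact: (kp _ (fun i => complex.Im p`_i))].
apply: eq_bigr => j _; apply: eq_bigr => i _.
by rewrite ks; ring.
Qed.

Lemma kernel_formB kappa kappa' p q :
  kernel_form (fun i j => kappa i j - kappa' i j) p q =
  kernel_form kappa p q - kernel_form kappa' p q.
Proof.
rewrite !kernel_formE -sumrB; apply: eq_bigr => i _; rewrite -sumrB.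
by apply: eq_bigr => j _; rewrite rmorphB mulrBr.
Qed.

(* [nu] and [mu] play the roles of multiplication by [z] and by [conj z]. *)
Theorem kernel_dilation kappa (nu mu : nat -> nat) :
  (forall i j, kappa i j = kappa j i) -> kernel_psd kappa ->
  (forall i j, kappa (nu i) j = kappa i (mu j)) ->
  (forall i, nu (mu i) = mu (nu i)) ->
  kernel_psd (fun i j => kappa i j - kappa (nu i) (nu j)) ->
  exists (k : nat -> l2 R) (N : {linear l2 R -> l2 R}),
    [/\ forall i j, hdot (k i) (k j) = (kappa i j)%:C%C, normal_operator N,
        forall x, `|N x| <= `|x| & forall i, N (k i) = k (nu i)].
Proof.
move=> ks kp adj comm contr.
pose X := poly_ext (fun i => 'X^(nu i) : {poly C}).
pose Y := poly_ext (fun i => 'X^(mu i) : {poly C}).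
have compl (V : lmodType C) (f : nat -> V) (h : nat -> nat) p :
    poly_ext f (poly_ext (fun i => 'X^(h i) : {poly C}) p) =
    poly_ext (fun i => f (h i)) p.
  rewrite linear_poly_ext; congr (poly_ext _ p); apply/funext => i.
  exact: poly_extXn.
have [|p|p|p q|p|p|phi [N [phiE Nn Nc NE]]] := @normal_dilation R {poly C}
    (kernel_form kappa) (@kernel_form_linear kappa) _ _ (fun n => 'X^n) _ X Y.
- by move=> p q; exact: kernel_form_sym.
- exact: kernel_form_ge0.
- exists (size p), (fun i => p`_i); exact: poly_sum_Xn.
- rewrite /kernel_form compl; congr (poly_ext _ p); apply/funext => i.
  by rewrite compl; under eq_fun do rewrite adj.
- rewrite [LHS](compl _ (fun i => 'X^(nu i))) [RHS](compl _ (fun i => 'X^(mu i))).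
  by congr (poly_ext _ p); apply/funext => i; rewrite comm.
- rewrite -subr_ge0.
  rewrite (_ : _ - _ = kernel_form (fun i j => kappa i j - kappa (nu i) (nu j)) p p).
    by apply: kernel_form_ge0 => // i j; rewrite !(ks i) (ks (nu i)).
  rewrite kernel_formB; congr (_ - _); rewrite /kernel_form compl.
  by congr (poly_ext _ p); apply/funext => i; rewrite compl.
exists (fun i => phi 'X^i), N; split => // [i j|i].
  rewrite phiE /kernel_form poly_extXn.
  by rewrite poly_extXn; apply/CrealP; rewrite complex_real.
by rewrite NE; congr (phi _); exact: poly_extXn.
Qed.

End KernelDilation.

Section MomentKernel.
Variable R : realType.
Implicit Types (b : R ^nat).

(** A number that decodes to nothing is read as the monomial 1; a repeated monomial is harmless for
    a semi-definite kernel. *)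
Let exponents (n : nat) : nat * nat := odflt (0, 0)%N (unpickle n).

(* With the natural number [n] coding the monomial [z^i * conj z^j], this is the
   inner product of monomials in L^2 of a rotation invariant measure, where
   [b n] is the integral of [|z|^(2n)]. *)
Definition moment_kernel b (m n : nat) : R :=
  let: (i, j) := exponents m in let: (k, l) := exponents n in
  if (i + l == j + k)%N then b (i + l)%N else 0.

Definition mul_z (n : nat) : nat := let: (i, j) := exponents n in pickle (i.+1, j).

Definition mul_zbar (n : nat) : nat := let: (i, j) := exponents n in pickle (i, j.+1).

Let exponents_pickle u : exponents (pickle u) = u.
Proof. by rewrite /exponents pickleK. Qed.

Lemma moment_kernel_sym b m n : moment_kernel b m n = moment_kernel b n m.
Proof.
rewrite /moment_kernel; case: (exponents m) (exponents n) => [i j] [k l].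
have -> : (k + j == l + i)%N = (i + l == j + k)%N by apply/eqP/eqP; lia.
by case: eqP => // ->; rewrite addnC.
Qed.

Lemma moment_kernel_adj b m n :
  moment_kernel b (mul_z m) n = moment_kernel b m (mul_zbar n).
Proof.
rewrite /moment_kernel /mul_z /mul_zbar.
case: (exponents m) (exponents n) => [i j] [k l]; rewrite !exponents_pickle.
by rewrite addnS addSn.
Qed.

Lemma mul_zC n : mul_z (mul_zbar n) = mul_zbar (mul_z n).
Proof. by rewrite /mul_z /mul_zbar; case: (exponents n) => i j; rewrite !exponents_pickle. Qed.

(** Thus multiplication by z is contractive as soon as the kernel of [nabla b] is positive. *)
Lemma moment_kernel_nabla b m n : moment_kernel (nabla b) m n =
  moment_kernel b m n - moment_kernel b (mul_z m) (mul_z n).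
Proof.
rewrite /moment_kernel /mul_z.
case: (exponents m) (exponents n) => [i j] [k l]; rewrite !exponents_pickle.
by rewrite addnS addSn eqSS; case: eqP => // _; rewrite subr0.
Qed.

(* Monomials with different values of [i - j] are orthogonal; on those with a
   given value of [i - j] the kernel is the Hankel kernel of a shift of [b]. *)
Lemma moment_kernel_psd b : hankel_psd b -> hankel_psd (fun k => b k.+1) ->
  kernel_psd (moment_kernel b).
Proof.
move=> b0 b1 n x.
(* [d] codes the integer i - j by its positive and negative parts. The class [c u] is an indicator
   function, so that classes form a finite type. *)
pose d (u : 'I_n) := let: (i, j) := exponents u in ((i - j), (j - i))%N.
pose m (u : 'I_n) := let: (i, j) := exponents u in minn i j.
pose c (u : 'I_n) : {ffun 'I_n -> bool} := [ffun v => d v == d u].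
rewrite (partition_big c xpredT) //=; apply: sumr_ge0 => S _.
have cE u v : (c u == c v) = (d u == d v).
  apply/eqP/eqP => [/ffunP/(_ u)|duv]; first by rewrite !ffunE eqxx => /esym/eqP.
  by apply/ffunP => w; rewrite !ffunE duv.
have [u0 /eqP u0S|noS] := pickP (fun u => c u == S); last by rewrite big_pred0.
(* [e] is |i - j|; for [u], [v] in the class of [u0], the exponent i + l equals [m u + m v + e]. *)
pose e := ((d u0).1 + (d u0).2)%N.
rewrite (_ : \sum_(u < n | _) _ = moment_functional (fun k => b (k + e)%N)
  ((\sum_u (if c u == S then x u else 0) *: 'X^(m u)) ^+ 2)).
  exact: hankel_psd_shift.
rewrite moment_functional_sqr big_mkcond; apply: eq_bigr => u _.
case: ifP => [/eqP uS|_]; last by rewrite big1 // => v _; rewrite !mul0r.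
apply: eq_bigr => v _; have : (c v == S) = (d u == d v) by rewrite -uS cE eq_sym.
have : d u = d u0 by apply/eqP; rewrite -cE uS u0S.
rewrite /e /d /m /moment_kernel => <-.
case: (exponents u) (exponents v) => [i j] [k l] /= ->.
have -> : (i + l == j + k)%N = ((i - j, j - i) == (k - l, l - k))%N.
  by apply/eqP/eqP => [|[]]; [move=> h; congr (_, _)|]; lia.
case: eqP => [[h1 h2]|_]; last by rewrite !mulr0 mul0r.
by congr (_ * b _); lia.
Qed.

End MomentKernel.

Section SubnormalShift.
Variable R : realType.
Implicit Types (alpha : R ^nat).

Lemma momentS alpha n : moment alpha n.+1 = moment alpha n * alpha n ^+ 2.
Proof. by rewrite /moment big_ord_recr. Qed.

Lemma moment_gt0 alpha n : (forall n, 0 < alpha n) -> 0 < moment alpha n.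
Proof. by move=> a0; apply: prodr_gt0 => i _; rewrite exprn_gt0. Qed.

Lemma wshift_contraction alpha (bd : bounded_fun alpha) :
  (forall n, 0 <= alpha n <= 1) -> forall x, `|wshift bd x| <= `|x|.
Proof.
move=> a01 x; rewrite -(@ler_pXn2r _ 2) ?nnegrE ?normr_ge0 // !l2_normE lecR.
apply: limr_le; first exact: (@l2_summable _ (wshift bd x)).
apply: nearW => -[|n].
  by rewrite /series /= big_geq // (le_trans _ (l2_partial_le x 0)) // /series /= big_geq.
apply: le_trans (l2_partial_le x n).
rewrite /series /= big_nat_recl //= {1}/sqnormc /= expr0n /= addr0 add0r.
apply: ler_sum => k _; rewrite sqnormcM ler_piMl ?sqnormc_ge0 //.
have /andP[ak0 ak1] := a01 k.
by rewrite /sqnormc /= expr0n addr0 expr_le1.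
Qed.

Theorem subnormal_wshift alpha (bd : bounded_fun alpha) :
  (forall n, 0 < alpha n <= 1) -> bounded_stieltjes (moment alpha) ->
  subnormal (wshift bd).
Proof.
move=> a01 mS; have a0 n : 0 < alpha n by case/andP: (a01 n).
pose g := moment alpha.
have g0 n : 0 < g n by exact: moment_gt0.
have [b0 b1 _] := mS; have [c0 c1 _] := bounded_stieltjes_nabla mS.
have [|k [N [kE Nn Nc NE]]] := @kernel_dilation R (moment_kernel g) mul_z mul_zbar
  (@moment_kernel_sym _ g) (moment_kernel_psd b0 b1) (@moment_kernel_adj _ g)
  mul_zC.
  move=> n x; have := moment_kernel_psd c0 c1 n x.
  by under eq_bigr do under eq_bigr do rewrite moment_kernel_nabla.
pose s n : R := Num.sqrt (g n).
have s0 n : 0 < s n by rewrite sqrtr_gt0.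
pose t n : l2 R := (s n)^-1%:C%C *: k (pickle (n, 0)%N).
have tE m n : hdot (t m) (t n) = (m == n)%:R.
  rewrite linearZl_LR linearZr_LR /= kE.
  rewrite /moment_kernel !pickleK /= addn0 add0n.
  have conjR (r : R) : conjC r%:C%C = r%:C%C by apply/CrealP; rewrite complex_real.
  rewrite conjR; case: eqP => [->|_]; last by rewrite !mulr0.
  rewrite -!rmorphM -[RHS](rmorph1 (real_complex R)); congr (_%:C%C).
  have -> : g n = s n ^+ 2 by rewrite sqr_sqrtr // ltW.
  by have := s0 n => sn; field; rewrite gt_eqF.
have sumE n (c : nat -> R[i]) :
    `|\sum_(i < n) c i *: t i| ^+ 2 = \sum_(i < n) `|c i| ^+ 2.
  rewrite hdotE linear_sumlz; apply: eq_bigr => i _ /=.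
  rewrite linear_sumr (bigD1 i) //= big1 ?addr0.
    by rewrite linearZl_LR linearZr_LR /= tE eqxx mulr1 normCK.
  move=> j ji; rewrite linearZl_LR linearZr_LR /= tE.
  by rewrite [_ == _](_ : _ = false) ?mulr0 //; apply/negbTE; rewrite eq_sym.
have [|V [Ve Vc]] := @l2_contraction_ext R (l2 R) t.
  by move=> n c; rewrite sumE.
exists (l2 R : hilbertType R), N, V; split => //.
  move=> x y; apply/eqP; rewrite -subr_eq0; apply/eqP; move: x y.
  apply: (@l2_sesquilinear_eq0 R (fun x y => hdot (V x) (V y) - hdot x y) 2) => //.
  - move=> y a u v; rewrite !linearP !linearPl /=.
    by rewrite -[a *: _]/(a * _); ring.
  - move=> x a u v; rewrite [V (_ + _)]linearP !linearPr /= !rmorphB !rmorphD !rmorphM /= !conjCK.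
    by rewrite -[a *: _]/(a * _); ring.
  - move=> x y; rewrite (le_trans (ler_normB _ _)) // -mulrA mulr_natl mulr2n.
    apply: lerD; apply: (le_trans (hdot_le_norm _ _)) => //.
    by rewrite ler_pM ?normr_ge0.
  - by move=> m n; rewrite !Ve tE hdot_basis /= eq_sym subrr.
move=> x; apply/eqP; rewrite -subr_eq0; apply/eqP; move: x.
apply: (@l2_bounded_linear_eq0 R (l2 R) (fun x => V (wshift bd x) - N (V x)) 2) => //.
- by move=> a u v; rewrite !linearP /= scalerBr addrACA scalerN.
- move=> x; rewrite (le_trans (ler_normB _ _)) // mulr_natl mulr2n lerD //.
    rewrite (le_trans (Vc _)) // wshift_contraction // => n.
    by case/andP: (a01 n) => /ltW -> ->.
  exact: le_trans (Nc _) (Vc _).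
move=> n; rewrite wshift_basis [V _]linearZ /= !Ve /t [N _]linearZ /= NE.
rewrite /mul_z pickleK /= scalerA -rmorphM.
(* Both sides are multiples of z^(n+1), with equal factors since s_(n+1) = s_n alpha_n. *)
rewrite [X in X%:C%C *: _ - _](_ : _ = (s n)^-1) ?subrr //.
rewrite /s /g momentS sqrtrM ?ltW // sqrtr_sqr gtr0_norm // invfM mulrCA.
by rewrite mulfV ?mulr1 // gt_eqF.
Qed.

End SubnormalShift.

(** * Hankel positivity from subnormality *)

Section SubnormalMoments.
Variable R : realType.
Implicit Types (alpha : R ^nat).

(** Each power of [S] crosses the inner product as a power of [N], after commuting past the powers
    of [N] already there. The value depends only on i + j, which exhibits a Hankel matrix as a Gram
    matrix. *)
Lemma hdot_normal_iter (K : hilbertType R) (N S : {linear K -> K}) (w : K) i j :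
  adjoint N S -> (forall x, N (S x) = S (N x)) ->
  hdot (iter i S (iter i N w)) (iter j S (iter j N w)) =
  hdot (iter (i + j) N w) (iter (i + j) N w).
Proof.
move=> adjN NS.
have adjS x y : hdot (S x) y = hdot x (N y).
  by rewrite hermC /= expr0 mul1r -adjN hermC /= expr0 mul1r conjCK.
have iterN n x y : hdot x (iter n S y) = hdot (iter n N x) y.
  by elim: n x => [//|n IH] x; rewrite iterS -adjN IH -iterSr.
have iterS' n x y : hdot (iter n S x) y = hdot x (iter n N y).
  by elim: n y => [//|n IH] y; rewrite iterS adjS IH -iterSr.
have NSn n x : N (iter n S x) = iter n S (N x).
  by elim: n => [//|n IH] /=; rewrite NS IH.
have NmSn m n x : iter m N (iter n S x) = iter n S (iter m N x).
  by elim: m => [//|m IH] /=; rewrite IH NSn.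
by rewrite iterN NmSn iterS' -!iterD addnC.
Qed.

Lemma subnormal_hankel_psd alpha (bd : bounded_fun alpha) e :
  subnormal (wshift bd) -> hankel_psd (fun k => moment alpha (k + e)%N).
Proof.
move=> [K [N [V [[_ [S adjN NS]] Viso VN]]]] p.
have We n : iter n (wshift bd) (l2_basis R 0) =
    (\prod_(i < n) alpha i)%:C%C *: l2_basis R n.
  elim: n => [|n IH]; first by rewrite big_ord0 scale1r.
  by rewrite iterS IH linearZ /= wshift_basis scalerA -rmorphM big_ord_recr.
have NV n x : iter n N (V x) = V (iter n (wshift bd) x).
  by elim: n => [//|n IH]; rewrite !iterS IH VN.
have normE n : hdot (iter n N (V (l2_basis R 0))) (iter n N (V (l2_basis R 0))) =
    (moment alpha n)%:C%C.
  rewrite NV Viso We linearZl_LR linearZr_LR /= hdot_basis /= eqxx mulr1.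
  rewrite (CrealP _) ?complex_real // -rmorphM /moment.
  by congr (_%:C%C); rewrite -expr2 prodrXl.
(* Starting from N^e v instead of v shifts the moments by [e], so both Hankel matrices are covered
   at once. *)
pose w := iter e N (V (l2_basis R 0)).
pose u i := iter i S (iter i N w).
rewrite -ler0c.
rewrite (_ : _%:C%C = hdot (\sum_(i < size p) (p`_i)%:C%C *: u i)
    (\sum_(i < size p) (p`_i)%:C%C *: u i)); first exact: dnorm_ge0.
rewrite {1}(poly_sum_Xn p) moment_functional_sqr rmorph_sum linear_sumlz.
apply: eq_bigr => i _; rewrite rmorph_sum linear_sumr; apply: eq_bigr => j _.
rewrite [RHS]linearZl_LR [X in _ = _ X]linearZr_LR /= (hdot_normal_iter _ _ _ adjN NS).
rewrite -iterD normE.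
by rewrite !rmorphM /= (CrealP _) ?complex_real // mulrA.
Qed.

Lemma norm_l2_basis n : `|l2_basis R n| = 1.
Proof.
apply/eqP; rewrite -(@eqrXn2 _ 2) // hdotE hdot_basis /= eqxx expr1n //.
Qed.

Lemma contractive_weights alpha (bd : bounded_fun alpha) :
  (opnorm (wshift bd) <= 1)%E -> forall n, alpha n <= 1.
Proof.
move=> W1 n; rewrite -lee_fin; apply: le_trans W1.
apply: le_trans (ereal_sup_ubound _); last first.
  by exists (l2_basis R n) => //=; rewrite norm_l2_basis.
rewrite wshift_basis normrZ norm_l2_basis mulr1 lee_fin normc_def /=.
by rewrite expr0n addr0 sqrtr_sqr ler_norm.
Qed.

Lemma moment_schur_pow alpha p n : (forall n, 0 < alpha n) ->
  moment (schur_pow alpha p) n = moment alpha n `^ p.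
Proof.
move=> a0; elim: n => [|n IH]; first by rewrite /moment !big_ord0 powR1.
rewrite !momentS IH /schur_pow powRM ?ltW ?moment_gt0 ?exprn_gt0 //.
by rewrite !expr2 powRM ?ltW.
Qed.

Lemma nabla_ln_moment alpha : (forall n, 0 < alpha n) ->
  nabla (fun k => ln (moment alpha k)) = (-2) *: (fun k => ln (alpha k)).
Proof.
move=> a0; apply/funext => k; rewrite /nabla momentS scalrfctE.
rewrite lnM ?posrE ?moment_gt0 ?exprn_gt0 // lnXn //.
rewrite -[RHS]/(-2 * _) -mulr_natl; ring.
Qed.

End SubnormalMoments.

(** * Equivalence of the six conditions for contractive shifts *)

Theorem theorem1p1 (R : realType) (alpha : R ^nat)
    (alpha_gt0 : forall n, 0 < alpha n) (alpha_bd : bounded_fun alpha)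
    (contractive : (opnorm (wshift alpha_bd) <= 1)%E) :
  let gamma := moment alpha in
  let M0 := moment_mx gamma 0 in
  let M1 := moment_mx gamma 1 in
  [<-> moment_infinitely_divisible alpha_bd;
       inf_cpd (log_mx M0) /\ inf_cpd (log_mx M1);
       forall p : R, 0 < p ->
         inf_posdef (schur_pow_mx M0 p) /\ inf_posdef (schur_pow_mx M1 p);
       forall p : R, 0 < p ->
         inf_cpd (schur_pow_mx M0 p) /\ inf_cpd (schur_pow_mx M1 p);
       log_completely_monotone gamma;
       log_completely_alternating alpha].
Proof.
have alpha_le1 := contractive_weights contractive.
move=> gamma M0 M1.
have gamma_gt0 k : 0 < gamma k by exact: moment_gt0.
pose g (e k : nat) := gamma (k + e)%N.
have g0E : g 0%N = gamma by apply/funext => k; rewrite /g addn0.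
have g1E : g 1%N = fun k => gamma k.+1 by apply/funext => k; rewrite /g addn1.
have posdefE e p : inf_posdef (schur_pow_mx (moment_mx gamma e) p) <->
    hankel_psd (fun k => g e k `^ p) by exact: inf_posdef_hankel.
have cpdE e p : inf_cpd (schur_pow_mx (moment_mx gamma e) p) <->
    hankel_cpd (fun k => g e k `^ p) by exact: inf_cpd_hankel.
have logE e : inf_cpd (log_mx (moment_mx gamma e)) <->
    hankel_cpd (fun k => ln (g e k)) by exact: inf_cpd_hankel.
have h13 : moment_infinitely_divisible alpha_bd -> forall p : R, 0 < p ->
    inf_posdef (schur_pow_mx M0 p) /\ inf_posdef (schur_pow_mx M1 p).
  move=> mid p p0; have psd e : hankel_psd (fun k => g e k `^ p).
    have := subnormal_hankel_psd e (mid p p0).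
    by under eq_fun do rewrite moment_schur_pow //.
  by split; apply/posdefE.
have h34 : (forall p : R, 0 < p ->
      inf_posdef (schur_pow_mx M0 p) /\ inf_posdef (schur_pow_mx M1 p)) ->
    forall p : R, 0 < p ->
      inf_cpd (schur_pow_mx M0 p) /\ inf_cpd (schur_pow_mx M1 p).
  move=> H p /H[/posdefE P0 /posdefE P1].
  by split; apply/cpdE => q _; [exact: P0|exact: P1].
have h42 : (forall p : R, 0 < p ->
      inf_cpd (schur_pow_mx M0 p) /\ inf_cpd (schur_pow_mx M1 p)) ->
    inf_cpd (log_mx M0) /\ inf_cpd (log_mx M1).
  move=> H; split; apply/logE; apply: hankel_cpd_ln => [k|q /H[]//].
  - exact: gamma_gt0.
  - by move=> /cpdE.
  - exact: gamma_gt0.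
  - by move=> _ /cpdE.
have h25 : inf_cpd (log_mx M0) /\ inf_cpd (log_mx M1) ->
    log_completely_monotone gamma.
  move=> [/logE + /logE]; rewrite g0E g1E => P0 P1; split => //.
  (* The first difference of ln gamma is -2 ln alpha, nonnegative by contractivity. *)
  apply: hankel_cpd_cm => // k; rewrite nabla_ln_moment // scalrfctE.
  by rewrite -[_ *: _]/(_ * _) mulNr oppr_ge0 mulr_ge0_le0 // ln_le0.
have h53 : log_completely_monotone gamma -> forall p : R, 0 < p ->
    inf_posdef (schur_pow_mx M0 p) /\ inf_posdef (schur_pow_mx M1 p).
  move=> [_ lcm] p p0.
  have cm n : n_monotone n (fun k => gamma k `^ p).
    exact: completely_monotone_powR.
  split; apply/posdefE; rewrite ?g0E ?g1E; apply: cm_hankel_psd => // n k.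
  by rewrite (iter_nabla_shift _ (fun k => gamma k `^ p)); exact: cm.
have h56 : log_completely_monotone gamma -> log_completely_alternating alpha.
  move=> [_ lcm]; split => // n n1 k.
  have := lcm n.+1 isT k; rewrite iterSr nabla_ln_moment // iter_nablaZ scalrfctE.
  by rewrite -[_ *: _]/(_ * _) mulNr oppr_ge0 pmulr_rle0.
have h65 : log_completely_alternating alpha -> log_completely_monotone gamma.
  move=> [_ lca]; split => // -[//|n] _ k.
  rewrite iterSr nabla_ln_moment // iter_nablaZ scalrfctE.
  rewrite -[_ *: _]/(_ * _) mulNr oppr_ge0 pmulr_rle0 //.
  (* Order 1 for ln gamma is order 0 for ln alpha, which complete alternation does not cover; it
     comes from [alpha_le1]. *)
  by case: n => [|n]; [rewrite /= ln_le0|exact: lca].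
have h31 : (forall p : R, 0 < p ->
      inf_posdef (schur_pow_mx M0 p) /\ inf_posdef (schur_pow_mx M1 p)) ->
    moment_infinitely_divisible alpha_bd.
  move=> H p p0; have [/posdefE P0 /posdefE P1] := H p p0.
  have s01 n : 0 < schur_pow alpha p n <= 1.
    have p1 : 1 `^ p = 1 :> R by rewrite powR1.
    rewrite /schur_pow powR_gt0 //= -[X in _ <= X]p1.
    by apply: ge0_ler_powR; rewrite ?nnegrE // ltW.
  have mE : moment (schur_pow alpha p) = fun k => gamma k `^ p.
    by apply/funext => k; exact: moment_schur_pow.
  apply: subnormal_wshift => //; rewrite g0E in P0; rewrite g1E in P1.
  split; [by rewrite mE|by rewrite mE|].
  exists 1 => k; rewrite ger0_norm; last by apply: prodr_ge0 => i _; rewrite sqr_ge0.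
  apply: prodr_ile1 => i _; rewrite sqr_ge0 expr_le1 //; case/andP: (s01 i) => //.
  by move=> /ltW.
(* The cycle in the listed order is composed from 1 => 3 => 4 => 2 => 5 => 3 => 1 and 5 <=> 6. *)
tfae; tauto.
Qed.
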